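(* Let $\mathcal{SV}=\mathcal{SV}[\Gamma,s]$ be the not-finitely graded generalized super-Virasoro algebra. Then $$\mathrm{Der}\,\mathcal{SV}=\bigoplus_{\gamma\in\Omega}(\mathrm{Der}\,\mathcal{SV})_\gamma=\mathrm{ad}\,\mathcal{SV}\oplus \mathrm{Hom}_{\mathbb Z}(\Omega,\mathbb C),$$ where $(\mathrm{Der}\,\mathcal{SV})_\gamma\subset \mathrm{ad}\,\mathcal{SV}$ if $\gamma\in\Omega\setminus\{0\}$, and $(\mathrm{Der}\,\mathcal{SV})_0=(\mathrm{ad}\,\mathcal{SV})_0\oplus\mathrm{Hom}_{\mathbb Z}(\Omega,\mathbb C)$.
   Context: All vector spaces are over $\mathbb C$; $\mathbb Z_+$ is the set of nonnegative integers. Let $\Gamma$ be an additive subgroup of $\mathbb C$ with $\mathbb Z\subseteq\Gamma$, let $s\in\mathbb C$ with $2s\in\Gamma$, and let $\Omega$ be the additive subgroup of $\mathbb C$ generated by $\Gamma\cup\{s\}$. $\mathcal{SV}=\mathcal{SV}[\Gamma,s]$ is the Lie superalgebra with basis $\{L_{\alpha,i},G_{\mu,j}\mid \alpha\in\Gamma,\ \mu\in s+\Gamma,\ i,j\in\mathbb Z_+\}$ and brackets $$[L_{\alpha,i},L_{\beta,j}]=(\beta-\alpha)L_{\alpha+\beta,i+j}+(j-i)L_{\alpha+\beta,i+j-1},$$ $$[L_{\alpha,i},G_{\mu,j}]=(\mu-\tfrac{\alpha}{2})G_{\alpha+\mu,i+j}+(j-\tfrac{i}{2})G_{\alpha+\mu,i+j-1},$$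 $$[G_{\mu,i},G_{\nu,j}]=2L_{\mu+\nu,i+j},$$ for $\alpha,\beta\in\Gamma$, $\mu,\nu\in s+\Gamma$, $i,j\in\mathbb Z_+$. Its even part is $\mathcal{SV}_{\bar 0}=\mathrm{span}\{L_{\alpha,i}\}$ and its odd part is $\mathcal{SV}_{\bar 1}=\mathrm{span}\{G_{\mu,i}\}$. Undefined symbols are treated as zero; e.g. $L_{\alpha,i}=0$ if $\alpha\notin\Gamma$, $G_{\mu,i}=0$ if $\mu\notin s+\Gamma$, and symbols with a negative second index are zero. $\mathcal{SV}$ is $\Omega$-graded: $\mathcal{SV}=\bigoplus_{\alpha\in\Omega}\mathcal{SV}_\alpha$, $\mathcal{SV}_\alpha=\mathrm{span}\{L_{\alpha,i},G_{\alpha,i}\mid i\in\mathbb Z_+\}$. For a Lie superalgebra $L$ and $\epsilon\in\mathbb Z_2$, a homogeneous derivation of degree $\epsilon$ is a linear map $D:L\to L$ with $D(L_{\delta})\subseteq L_{\delta+\epsilon}$ for $\delta\in\mathbb Z_2$ and $D([x,y])=[D(x),y]+(-1)^{|D||x|}[x,D(y)]$ for all homogeneous $x,y$, where $|D|=\epsilon$; $\mathrm{Der}_\epsilon L$ is the set of these and $\mathrm{Der}\,L=\mathrm{Der}_{\bar 0}L\oplus\mathrm{Der}_{\bar 1}L$. For $z\in L$, $\mathrm{ad}_z(y)=[z,y]$, and $\mathrm{ad}\,L=\{\mathrm{ad}_z\mid z\in L\}$. For $\gamma\in\Omega$, $(\mathrm{Der}\,\mathcal{SV})_\gamma=\{D\in\mathrm{Der}\,\mathcal{SV}\mid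 D(\mathcal{SV}_\alpha)\subseteq\mathcal{SV}_{\alpha+\gamma}\ \forall\alpha\in\Omega\}$, and $(\mathrm{ad}\,\mathcal{SV})_0=\mathrm{ad}\,\mathcal{SV}\cap(\mathrm{Der}\,\mathcal{SV})_0$. $\mathrm{Hom}_{\mathbb Z}(\Omega,\mathbb C)$ is the space of group homomorphisms $\Omega\to\mathbb C$. Each $\phi\in\mathrm{Hom}_{\mathbb Z}(\Omega,\mathbb C)$ gives a derivation $D_\phi$ by $D_\phi(L_{\alpha,i})=\phi(\alpha)L_{\alpha,i}$, $D_\phi(G_{\alpha,i})=\phi(\alpha)G_{\alpha,i}$ for $\alpha\in\Omega$, $i\in\mathbb Z_+$; in the claim $\mathrm{Hom}_{\mathbb Z}(\Omega,\mathbb C)$ denotes the corresponding subspace $\{D_\phi\}$ of $\mathrm{Der}\,\mathcal{SV}$. *)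

(* Defs.v *)
From HB Require Import structures.
From mathcomp Require Import all_boot all_order all_algebra.
From mathcomp Require Import ring.
From mathcomp Require Import mathcomp_extra boolp classical_sets functions.
From mathcomp Require Import cardinality fsbigop reals.
From mathcomp Require Import complex.
From mathcomp Require Import freeg.

Set Implicit Arguments.
Unset Strict Implicit.
Unset Printing Implicit Defensive.

Import Order.TTheory GRing.Theory Num.Theory.

Local Open Scope classical_set_scope.
Local Open Scope ring_scope.

Definition is_subgroup (V : zmodType) (A : set V) : Prop :=
  A 0 /\ forall u v, A u -> A v -> A (u - v).

Section Subspaces.
Variables (K : fieldType) (V : lmodType K).

Definition is_subspace (A : set V) : Prop :=
  A 0 /\ forall (a : K) u v, A u -> A v -> A (a *: u + v).

Definition span (A : set V) : set V := smallest is_subspace A.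

Definition sum_set (A B : set V) : set V := [set u + v | u in A & v in B].

Definition is_direct_sum2 (W A B : set V) : Prop :=
  [/\ is_subspace A, is_subspace B, W = sum_set A B & A `&` B = [set 0]].

Definition finsupp_in (I : choiceType) (A : I -> set V) (f : I -> V) : Prop :=
  finite_set [set i | f i <> 0] /\ forall i, A i (f i).

(* The index type may be infinite: elements of the direct sum are sums of
   finitely supported families *)
Definition is_direct_sum (I : choiceType) (W : set V) (A : I -> set V) : Prop :=
  [/\ forall i, is_subspace (A i),
      W = [set w | exists2 f, finsupp_in A f & w = \sum_(i \in [set: I]) f i]
    & forall f, finsupp_in A f -> \sum_(i \in [set: I]) f i = 0 ->
        forall i, f i = 0].

Lemma is_subspace_span (A : set V) : is_subspace (span A).
Proof.
split=> [B [[B0 _] _] //|a u v uA vA B BA].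
by case: (BA) => -[_ BL] _; apply: BL; [exact: uA|exact: vA].
Qed.

End Subspaces.

(* Z/2 is rendered by bool, with addition (+) (addb) and product && *)
HB.mixin Record isLieSuperalgebra (K : fieldType) L of GRing.Lmodule K L := {
  superpart : bool -> set L;
  lie : L -> L -> L;
  superpart_direct :
    is_direct_sum2 [set: L] (superpart false) (superpart true);
  lie_linearl : forall y, linear (fun x => lie x y);
  lie_linearr : forall x, linear (lie x);
  lie_superpart : forall d e x y, superpart d x -> superpart e y ->
    superpart (d (+) e) (lie x y);
  lie_super_antisym : forall d e x y, superpart d x -> superpart e y ->
    lie x y = - ((-1) ^+ (d && e) *: lie y x);
  lie_super_jacobi : forall d e f x y z,
    superpart d x -> superpart e y -> superpart f z ->
    lie x (lie y z) = lie (lie x y) z + (-1) ^+ (d && e) *: lie y (lie x z)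
}.

#[short(type="lieSuperalgType")]
HB.structure Definition LieSuperalgebra (K : fieldType) :=
  { L of isLieSuperalgebra K L & GRing.Lmodule K L }.

Section Derivations.
Variables (K : fieldType) (L : lieSuperalgType K).

Definition Der_homogeneous (e : bool) : set (L -> L) :=
  [set D | [/\ linear D,
     forall d x, superpart d x -> superpart (d (+) e) (D x)
   & forall d d' x y, superpart d x -> superpart d' y ->
       D (lie x y) = lie (D x) y + (-1) ^+ (e && d) *: lie x (D y)]].

Definition Der : set (L -> L) :=
  sum_set (Der_homogeneous false) (Der_homogeneous true).

Definition ad : set (L -> L) := [set lie z | z in [set: L]].

End Derivations.

Arguments Der {K} L.
Arguments ad {K} L.

Section Omega.
Variables (K : numFieldType) (Gamma : zmodClosed K) (s : K).

Definition Omega_pred : {pred K} :=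
  [pred x | x \in smallest (@is_subgroup K)
                    ([set y | y \in Gamma] `|` [set s])].

Lemma Omega_zmod_closed : zmod_closed Omega_pred.
Proof.
split=> [|u v]; rewrite !inE; first by move=> B [[B0 _] _].
move=> uA vA B BA.
by case: (BA) => -[_ BL] _; apply: BL; [exact: uA|exact: vA].
Qed.

HB.instance Definition _ :=
  GRing.isZmodClosed.Build K Omega_pred Omega_zmod_closed.

Definition Omega := {x : K | x \in Omega_pred}.

HB.instance Definition _ := SubType.on Omega.
HB.instance Definition _ := Choice.on Omega.
HB.instance Definition _ := [SubChoice_isSubZmodule of Omega by <:].

End Omega.

Section FreegLinear.
Variables (K : nzRingType) (I : choiceType) (M : lmodType K).
Implicit Types (f g : I -> M) (u v : {freeg I / K}).

Lemma fgliftD f u v : fglift f (u + v) = fglift f u + fglift f v.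
Proof.
have fB := @lift_is_additive K I M f.
have f0 : fglift f 0 = 0 by rewrite -(subrr 0) fB subrr.
by rewrite -[v in LHS]opprK fB -(sub0r v) fB f0 sub0r opprK.
Qed.

Lemma fglift0 f : fglift f 0 = 0.
Proof. by apply: (addrI (fglift f 0)); rewrite -fgliftD !addr0. Qed.

Lemma fgliftZ f a u : fglift f (a *: u) = a *: fglift f u.
Proof.
elim/freeg_ind_dom0: u => [|k x u _ _ IHu].
  by rewrite scaler0 fglift0 scaler0.
rewrite scalerDr !fgliftD IHu scalerDr; congr (_ + _).
have -> : a *: << k *g x >> = << (a * k) *g x >>.
  by apply/eqP/freeg_eqP => y; rewrite coeffZ !coeffU mulrA.
by rewrite !liftU scalerA.
Qed.

Lemma fglift_linear f : linear (fglift f).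
Proof. by move=> a u v; rewrite fgliftD fgliftZ. Qed.

End FreegLinear.

Lemma fglift_fun_linear (K : comNzRingType) (I : choiceType)
    (V M : lmodType K) (F : I -> V -> M) (u : {freeg I / K}) :
  (forall k, linear (F k)) -> linear (fun v => fglift (F^~ v) u).
Proof.
move=> Flin a v w; elim/freeg_ind_dom0: u => [|k x u _ _ IHu].
  by rewrite !fglift0 scaler0 addr0.
rewrite !fgliftD IHu !liftU Flin !scalerDr !scalerA addrACA.
by rewrite [k * a]mulrC.
Qed.

Section SuperVirasoro.
Variables (K : numFieldType) (Gamma : zmodClosed K) (s : K).

(* (false, alpha, i) indexes L_{alpha,i} and (true, mu, i) indexes G_{mu,i} *)
Definition sv_index_pred : {pred bool * K * nat} :=
  [pred k | k.1.2 - (if k.1.1 then s else 0) \in Gamma].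

Definition sv_index := {k : bool * K * nat | k \in sv_index_pred}.

HB.instance Definition _ := SubType.on sv_index.
HB.instance Definition _ := Choice.on sv_index.

Definition SV := {freeg sv_index / K}.

HB.instance Definition _ := GRing.Lmodule.copy SV {freeg sv_index / K}.

Definition sv_sym (b : bool) (x : K) (i : nat) : SV :=
  if insub (b, x, i) is Some k then << k >> else 0.

Definition sv_L : K -> nat -> SV := sv_sym false.
Definition sv_G : K -> nat -> SV := sv_sym true.

(* When i = j = 0 the coefficient of the symbol with second index
   (i + j).-1 is zero, so truncation of the predecessor is harmless *)
Definition sv_bracket_index (k l : bool * K * nat) : SV :=
  let: (a, x, i) := k in
  let: (b, y, j) := l in
  match a, b with
  | false, false => (y - x) *: sv_L (x + y) (i + j)
                    + (j%:R - i%:R) *: sv_L (x + y) (i + j).-1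
  | false, true => (y - x / 2) *: sv_G (x + y) (i + j)
                   + (j%:R - i%:R / 2) *: sv_G (x + y) (i + j).-1
  | true, false => - ((x - y / 2) *: sv_G (y + x) (j + i)
                      + (i%:R - j%:R / 2) *: sv_G (y + x) (j + i).-1)
  | true, true => 2 *: sv_L (x + y) (i + j)
  end.

Definition sv_bracket (u v : SV) : SV :=
  fglift (fun k => fglift (fun l => sv_bracket_index (val k) (val l)) v) u.

Definition sv_part (b : bool) : set SV :=
  span [set sv_sym b x i | x in [set: K] & i in [set: nat]].

Lemma sv_bracket_linearl v : linear (fun u => sv_bracket u v).
Proof. exact: fglift_linear. Qed.

Lemma sv_bracket_linearr u : linear (sv_bracket u).
Proof. by apply: fglift_fun_linear => k; exact: fglift_linear. Qed.

Lemma sv_symE b x i (h : (b, x, i) \in sv_index_pred) :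
  sv_sym b x i = << (Sub (b, x, i) h : sv_index) >>.
Proof. by rewrite /sv_sym insubT. Qed.

Lemma sv_sym0 b x i : (b, x, i) \notin sv_index_pred -> sv_sym b x i = 0.
Proof. by move=> h; rewrite /sv_sym insubN. Qed.

Lemma sv_bracketE k l : k \in sv_index_pred -> l \in sv_index_pred ->
  sv_bracket (sv_sym k.1.1 k.1.2 k.2) (sv_sym l.1.1 l.1.2 l.2) =
  sv_bracket_index k l.
Proof.
case: k l => [[a x] i] [[b y] j] hk hl /=.
by rewrite !sv_symE /sv_bracket !liftU !scale1r.
Qed.

Lemma sv_sym_part b x i : sv_part b (sv_sym b x i).
Proof. by apply: sub_gen_smallest; exists x => //; exists i. Qed.

Lemma sv_bracket0l v : sv_bracket 0 v = 0.
Proof. exact: fglift0. Qed.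

Lemma sv_bracket0r u : sv_bracket u 0 = 0.
Proof.
have := sv_bracket_linearr u (-1) 0 0.
by rewrite scaleN1r !addr0 oppr0 scaleN1r addNr.
Qed.

Lemma sv_part_ind b (P : SV -> Prop) :
  P 0 -> (forall a u v, P u -> P v -> P (a *: u + v)) ->
  (forall x i, (b, x, i) \in sv_index_pred -> P (sv_sym b x i)) ->
  forall u, sv_part b u -> P u.
Proof.
move=> P0 PL Psym u uP; apply: uP; split=> // _ [x _ [i _ <-]].
by case: (boolP ((b, x, i) \in sv_index_pred)) => [/Psym//|/sv_sym0->].
Qed.

Lemma sv_part_subspace b : is_subspace (sv_part b).
Proof. exact: is_subspace_span. Qed.

Lemma sv_part_lin b a u v :
  sv_part b u -> sv_part b v -> sv_part b (a *: u + v).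
Proof. by have [_] := @sv_part_subspace b; apply. Qed.

Lemma sv_part0 b : sv_part b 0.
Proof. by have [] := @sv_part_subspace b. Qed.

Lemma sv_partD b u v : sv_part b u -> sv_part b v -> sv_part b (u + v).
Proof. by rewrite -[u in u + v]scale1r; exact: sv_part_lin. Qed.

Lemma sv_partZ b a u : sv_part b u -> sv_part b (a *: u).
Proof.
move=> uP; rewrite -[_ *: _]addr0; apply: sv_part_lin => //.
exact: sv_part0.
Qed.

Lemma sv_part_coeff b u (k : sv_index) :
  sv_part b u -> (val k).1.1 != b -> coeff k u = 0.
Proof.
move=> uP hk; move: u uP; apply: sv_part_ind => [|a u v IHu IHv|x i h].
- by rewrite coeff0.
- by rewrite coeffD coeffZ IHu IHv mulr0 addr0.
rewrite sv_symE coeffU mul1r; case: eqP => // ek.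
by move: hk; rewrite -ek SubK eqxx.
Qed.

Lemma sv_part_direct :
  is_direct_sum2 [set: SV] (sv_part false) (sv_part true).
Proof.
split; [exact: is_subspace_span|exact: is_subspace_span| |].
- apply/seteqP; split=> // u _.
  elim/freeg_ind_dom0: u => [|c k u _ _ [v vP [w wP <-]]].
    by exists 0; [exact: sv_part0|exists 0; [exact: sv_part0|rewrite addr0]].
  have kE : << c *g k >> = c *: sv_sym (val k).1.1 (val k).1.2 (val k).2 :> SV.
    case: k => -[[b x] i] h /=; rewrite sv_symE.
    by apply/eqP/freeg_eqP => y; rewrite coeffZ !coeffU mul1r.
  have := @sv_sym_part (val k).1.1 (val k).1.2 (val k).2.
  move: kE; case: (val k).1.1 => kE kP.
    exists v => //; exists (c *: sv_sym true (val k).1.2 (val k).2 + w).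
      exact: sv_part_lin.
    by rewrite kE addrCA.
  exists (c *: sv_sym false (val k).1.2 (val k).2 + v).
    exact: sv_part_lin.
  by exists w => //; rewrite kE addrA.
- apply/seteqP; split=> [u [u0 u1]|u ->]; last by split; exact: sv_part0.
  apply/eqP/freeg_eqP => k; rewrite coeff0.
  case kb: (val k).1.1; first by apply: (sv_part_coeff u0); rewrite kb.
  by apply: (sv_part_coeff u1); rewrite kb.
Qed.

Definition sv_valid b x := ((b, x, 0%N) \in sv_index_pred).

Definition sv_poly b x (p : {poly K}) : SV :=
  \sum_(i < size p) p`_i *: sv_sym b x i.

Lemma sv_polyE b x (p : {poly K}) n : (size p <= n)%N ->
  sv_poly b x p = \sum_(i < n) p`_i *: sv_sym b x i.
Proof.
move=> hp; rewrite /sv_poly (big_ord_widen n (fun i => p`_i *: sv_sym b x i)) //.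
rewrite [RHS](bigID (fun i : 'I_n => (i < size p)%N)) /= [X in _ + X]big1 ?addr0 //.
by move=> i; rewrite -leqNgt => hi; rewrite nth_default // scale0r.
Qed.

Lemma sv_poly_linear b x : linear (sv_poly b x).
Proof.
move=> c p q; pose n := maxn (size (c *: p + q)) (maxn (size p) (size q)).
rewrite !(@sv_polyE _ _ _ n) ?leq_max ?leqnn ?orbT //.
rewrite scaler_sumr -big_split; apply: eq_bigr => i _ /=.
by rewrite coefD coefZ scalerDl scalerA.
Qed.

Lemma sv_polyD b x p q : sv_poly b x (p + q) = sv_poly b x p + sv_poly b x q.
Proof. by have := sv_poly_linear b x 1 p q; rewrite !scale1r. Qed.

Lemma sv_poly0 b x : sv_poly b x 0 = 0.
Proof. by rewrite /sv_poly size_poly0 big_ord0. Qed.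

Lemma sv_polyZ b x c p : sv_poly b x (c *: p) = c *: sv_poly b x p.
Proof. by have := sv_poly_linear b x c p 0; rewrite sv_poly0 !addr0. Qed.

Lemma sv_polyN b x p : sv_poly b x (- p) = - sv_poly b x p.
Proof. by rewrite -scaleN1r sv_polyZ scaleN1r. Qed.

Lemma sv_polyXn b x i : sv_poly b x 'X^i = sv_sym b x i.
Proof.
rewrite /sv_poly size_polyXn big_ord_recr /= coefXn eqxx scale1r big1 ?add0r //.
by move=> j _; rewrite coefXn ltn_eqF ?scale0r.
Qed.

Lemma sv_poly_invalid b x p : ~~ sv_valid b x -> sv_poly b x p = 0.
Proof.
move=> h; rewrite /sv_poly big1 // => i _.
by rewrite sv_sym0 ?scaler0 // inE; move: h; rewrite /sv_valid inE.
Qed.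

Lemma linear_poly_ext (M : lmodType K) (f g : {poly K} -> M) :
  linear f -> linear g -> (forall i, f 'X^i = g 'X^i) -> f =1 g.
Proof.
move=> fl gl fg p; rewrite -[p]coefK poly_def.
have f0 : f 0 = 0 by have := fl (-1) 0 0; rewrite scaleN1r !addr0 oppr0 scaleN1r addNr.
have g0 : g 0 = 0 by have := gl (-1) 0 0; rewrite scaleN1r !addr0 oppr0 scaleN1r addNr.
apply: (big_ind (fun u => f u = g u)) => [|u v Eu Ev|i _].
- by rewrite f0 g0.
- by rewrite -[u]scale1r fl gl Eu Ev.
- by rewrite -[_ *: _]addr0 fl gl f0 g0 fg.
Qed.

Definition sv_poly_bracket (a b : bool) (x y : K) (p q : {poly K}) : {poly K} :=
  match a, b with
  | false, false => (y - x) *: (p * q) + (p * q^`() - p^`() * q)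
  | false, true => (y - x / 2) *: (p * q) + (p * q^`() - 2^-1 *: (p^`() * q))
  | true, false => - ((x - y / 2) *: (p * q) + (p^`() * q - 2^-1 *: (p * q^`())))
  | true, true => 2 *: (p * q)
  end.

Lemma sv_poly_bracket_linearl a b x y q :
  linear (fun p => sv_poly_bracket a b x y p q).
Proof.
by move=> c p r; case: a; case: b; rewrite /= ?derivD ?derivZ -!mul_polyC; ring.
Qed.

Lemma sv_poly_bracket_linearr a b x y p :
  linear (sv_poly_bracket a b x y p).
Proof.
by move=> c q r; case: a; case: b; rewrite /= ?derivD ?derivZ -!mul_polyC; ring.
Qed.

Lemma polyXn_mul_deriv i j :
  'X^i * ('X^j)^`() = j%:R *: 'X^((i + j).-1) :> {poly K}.
Proof.
case: j => [|j]; first by rewrite expr0 derivC mulr0 scale0r.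
by rewrite derivXn addnS /= exprD scaler_nat mulrnAr.
Qed.

Lemma sv_validE b x i : ((b, x, i) \in sv_index_pred) = sv_valid b x.
Proof. by rewrite /sv_valid !inE. Qed.

Lemma sv_bracket_poly_valid a b x y p q : sv_valid a x -> sv_valid b y ->
  sv_bracket (sv_poly a x p) (sv_poly b y q) =
  sv_poly (a (+) b) (x + y) (sv_poly_bracket a b x y p q).
Proof.
move=> hx hy.
move: p; apply: linear_poly_ext => [c p r|c p r|i].
- by rewrite sv_poly_linear sv_bracket_linearl.
- by rewrite sv_poly_bracket_linearl sv_poly_linear.
move: q; apply: linear_poly_ext => [c p r|c p r|j].
- by rewrite sv_poly_linear sv_bracket_linearr.
- by rewrite sv_poly_bracket_linearr sv_poly_linear.
rewrite !sv_polyXn (@sv_bracketE (a, x, i) (b, y, j)) ?sv_validE //.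
have E2 : ('X^i)^`() * 'X^j = i%:R *: 'X^((i + j).-1) :> {poly K}.
  by rewrite mulrC polyXn_mul_deriv addnC.
case: a {hx}; case: b {hy}; rewrite /= ?polyXn_mul_deriv ?E2 -?exprD.
- by rewrite sv_polyZ sv_polyXn.
- rewrite scalerA -scalerBl sv_polyN sv_polyD !sv_polyZ !sv_polyXn.
  by rewrite [y + x]addrC [(j + i)%N]addnC [2^-1 * _]mulrC.
- rewrite scalerA -scalerBl sv_polyD !sv_polyZ !sv_polyXn.
  by rewrite [2^-1 * _]mulrC.
- by rewrite -scalerBl sv_polyD !sv_polyZ !sv_polyXn.
Qed.

Lemma sv_bracket_poly a b x y p q :
  a ==> sv_valid a x -> b ==> sv_valid b y -> sv_valid a x || sv_valid b y ->
  sv_bracket (sv_poly a x p) (sv_poly b y q) =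
  sv_poly (a (+) b) (x + y) (sv_poly_bracket a b x y p q).
Proof.
have [hx|hx] := boolP (sv_valid a x); have [hy|hy] := boolP (sv_valid b y).
- by move=> _ _ _; apply: sv_bracket_poly_valid.
- case: b hy => // hy _ _ _; rewrite (sv_poly_invalid _ hy).
  rewrite sv_bracket0r addbF sv_poly_invalid //; apply: contra hy.
  move: hx; rewrite /sv_valid !inE /= subr0 => hx hxy.
  have -> : y = (x + y - (if a then s else 0)) - (x - (if a then s else 0)) by ring.
  exact: rpredB.
- case: a hx => // hx _ _ _; rewrite (sv_poly_invalid _ hx) sv_bracket0l.
  rewrite addFb sv_poly_invalid //; apply: contra hx.
  move: hy; rewrite /sv_valid !inE /= subr0 => hy hxy.
  have -> : x = (x + y - (if b then s else 0)) - (y - (if b then s else 0)) by ring.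
  exact: rpredB.
- by [].
Qed.

Lemma sv_part_poly b (P : SV -> Prop) :
  P 0 -> (forall a u v, P u -> P v -> P (a *: u + v)) ->
  (forall x i, sv_valid b x -> P (sv_poly b x 'X^i)) ->
  forall u, sv_part b u -> P u.
Proof.
move=> P0 PL Psym; apply: sv_part_ind => // x i.
by rewrite sv_validE -sv_polyXn; exact: Psym.
Qed.

Lemma sv_valid_add a b x y : sv_valid a x -> sv_valid b y -> ~~ (a && b) ->
  sv_valid (a (+) b) (x + y).
Proof.
rewrite /sv_valid !inE /= => hx hy; case: a hx; case: b hy => //= hy hx _.
- have -> : x + y - s = (x - s) + (y - 0) by ring.
  exact: rpredD.
- have -> : x + y - s = (x - 0) + (y - s) by ring.
  exact: rpredD.
- have -> : x + y - 0 = (x - 0) + (y - 0) by ring.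
  exact: rpredD.
Qed.

Lemma sv_poly_part b x p : sv_part b (sv_poly b x p).
Proof.
rewrite /sv_poly; apply: (big_ind (sv_part b)) => [|u v|i _].
- exact: sv_part0.
- exact: sv_partD.
- by apply: sv_partZ; exact: sv_sym_part.
Qed.

Lemma sv_bracket_part d e u v : sv_part d u -> sv_part e v ->
  sv_part (d (+) e) (sv_bracket u v).
Proof.
move=> uP; move: v; apply: sv_part_poly => [|a v w IHv IHw|y j hy].
- by rewrite sv_bracket0r; exact: sv_part0.
- by rewrite sv_bracket_linearr; exact: sv_part_lin.
move: u uP; apply: sv_part_poly => [|a v w IHv IHw|x i hx].
- by rewrite sv_bracket0l; exact: sv_part0.
- by rewrite sv_bracket_linearl; exact: sv_part_lin.
by rewrite sv_bracket_poly_valid //; exact: sv_poly_part.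
Qed.

Lemma sv_bracket_super_antisym d e u v : sv_part d u -> sv_part e v ->
  sv_bracket u v = - ((-1) ^+ (d && e) *: sv_bracket v u).
Proof.
move=> uP; move: v; apply: sv_part_poly => [|a v w IHv IHw|y j hy].
- by rewrite sv_bracket0r sv_bracket0l scaler0 oppr0.
- rewrite sv_bracket_linearr sv_bracket_linearl IHv IHw.
  by rewrite scalerDr opprD !scalerA scalerN scalerA [a * _]mulrC.
move: u uP; apply: sv_part_poly => [|a v w IHv IHw|x i hx].
- by rewrite sv_bracket0r sv_bracket0l scaler0 oppr0.
- rewrite sv_bracket_linearr sv_bracket_linearl IHv IHw.
  by rewrite scalerDr opprD !scalerA scalerN scalerA [a * _]mulrC.
rewrite !sv_bracket_poly_valid // [e (+) d]addbC [y + x]addrC.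
rewrite -sv_polyZ -sv_polyN; congr sv_poly.
by case: d {hx}; case: e {hy}; rewrite /= ?expr0 ?expr1 -!mul_polyC; ring.
Qed.

Lemma sv_bracket_super_jacobi d e f u v w :
  sv_part d u -> sv_part e v -> sv_part f w ->
  sv_bracket u (sv_bracket v w) =
  sv_bracket (sv_bracket u v) w
  + (-1) ^+ (d && e) *: sv_bracket v (sv_bracket u w).
Proof.
move=> uP vP; move: w; apply: sv_part_poly => [|a w t IHw IHt|z k hz].
- by rewrite !sv_bracket0r scaler0 addr0.
- rewrite !sv_bracket_linearr IHw IHt !scalerDr !scalerA [a * _]mulrC.
  by rewrite addrACA.
move: v vP; apply: sv_part_poly => [|a w t IHw IHt|y j hy].
- by rewrite !sv_bracket0r !sv_bracket0l !sv_bracket0r scaler0 addr0.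
- rewrite !(sv_bracket_linearr, sv_bracket_linearl) IHw IHt.
  by rewrite !scalerDr !scalerA [a * _]mulrC addrACA.
move: u uP; apply: sv_part_poly => [|a w t IHw IHt|x i hx].
- by rewrite !sv_bracket0l !sv_bracket0r scaler0 addr0.
- rewrite !(sv_bracket_linearr, sv_bracket_linearl) IHw IHt.
  by rewrite !scalerDr !scalerA [a * _]mulrC addrACA.
have V a b s' t : sv_valid a s' -> sv_valid b t ->
    (a (+) b) ==> sv_valid (a (+) b) (s' + t).
  move=> ha hb; apply/implyP => ab; apply: sv_valid_add => //.
  by case: a b ab {ha hb} => [] [].
rewrite !sv_bracket_poly ?hx ?hy ?hz ?orbT ?implybT ?V //.
rewrite -sv_polyZ [y + (x + z)]addrCA [x + (y + z)]addrA.
rewrite [in RHS]addbCA !addbA -sv_polyD.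
congr sv_poly.
have hh : 2 * (2^-1)%:P = 1 :> {poly K}.
  by rewrite -[2]/(2%:R) -polyC_natr -polyCM divff // pnatr_eq0.
case: d {hx V}; case: e {hy}; case: f {hz}; rewrite /= ?expr0 ?expr1;
  rewrite ?(derivB, derivD, derivN, derivZ, derivM) -!mul_polyC;
  rewrite ?(polyCB, polyCD, polyCM, polyCN) ?polyC1.
all: move: (2^-1)%:P hh => h hh.
all: try (by ring: hh).
(* the remaining identities are affine in h *)
all: match goal with hh : 2 * ?h = 1 |- ?l = ?r =>
  match eval pattern h in (l - r) with
  | ?F h => let c := eval cbv beta in (F 0) in
            apply: subr0_eq; transitivity (- c * (2 * h - 1)); first by ring
  end end.
all: by rewrite hh subrr mulr0.
Qed.

HB.instance Definition _ := isLieSuperalgebra.Build K SV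
  sv_part_direct sv_bracket_linearl sv_bracket_linearr
  sv_bracket_part sv_bracket_super_antisym sv_bracket_super_jacobi.

Definition sv_deg (alpha : Omega Gamma s) : set SV :=
  span [set v | exists i, v = sv_L (val alpha) i \/ v = sv_G (val alpha) i].

Definition Der_deg (gamma : Omega Gamma s) : set (SV -> SV) :=
  [set D | Der SV D /\
    forall alpha v, sv_deg alpha v -> sv_deg (alpha + gamma) (D v)].

(* The second component of an index lies in Gamma or in s + Gamma, hence
   in Omega, so the default value of insubd is never used *)
Definition sv_diag (phi : {additive Omega Gamma s -> K}) : SV -> SV :=
  fglift (fun k : sv_index => phi (insubd 0 (val k).1.2) *: << k >>).

Lemma sv_diag_sym phi b (alpha : Omega Gamma s) i :
  sv_diag phi (sv_sym b (val alpha) i) = phi alpha *: sv_sym b (val alpha) i.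
Proof.
have [h|h] := boolP ((b, val alpha, i) \in sv_index_pred).
  by rewrite sv_symE /sv_diag liftU scale1r SubK valKd.
by rewrite sv_sym0 // scaler0 /sv_diag fglift0.
Qed.

Lemma sv_diagL phi (alpha : Omega Gamma s) i :
  sv_diag phi (sv_L (val alpha) i) = phi alpha *: sv_L (val alpha) i.
Proof. exact: sv_diag_sym. Qed.

Lemma sv_diagG phi (alpha : Omega Gamma s) i :
  sv_diag phi (sv_G (val alpha) i) = phi alpha *: sv_G (val alpha) i.
Proof. exact: sv_diag_sym. Qed.

Definition Hom_Omega : set (SV -> SV) :=
  [set sv_diag phi | phi in [set: {additive Omega Gamma s -> K}]].

End SuperVirasoro.

Arguments Der_deg {K Gamma s}.
Arguments Hom_Omega {K} Gamma s.

(* Main.v *)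
(* Writing L_x(p) and G_x(p) for a polynomial p in place of t^i, the operator
   ad L_0(1) acts on the components L_x and G_x as x + d/dt, which is always
   surjective, and is injective when x <> 0. Hence subtracting an inner
   derivation from a homogeneous derivation D makes it kill L_0(1), so that D
   commutes with x + d/dt; comparing generalized eigenspaces, D preserves the
   x-degree. Then D(L_0(t)) is a constant multiple of L_0(1) or G_0(1), and a
   second inner correction, centralizing L_0(1), makes D kill L_0(t) as well.
   If D is even, commuting with ad L_0(t) and with d/dt forces it to commute with
   multiplication by t, so D is a scalar on each L_x and each G_x; evaluating D
   on brackets shows that these scalars form an additive function on Omega.
   If D is odd, it also kills G_0(1) and G_0(t), and the derivation rule for these two
   elements gives D = 0. The graded statements follow since ad z is the finite
   sum of the ad z_gamma. *)
Require Import Defs.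
From HB Require Import structures.
From mathcomp Require Import all_boot all_order all_algebra.
From mathcomp Require Import ring finmap freeg.
From mathcomp Require Import boolp classical_sets functions cardinality.
From mathcomp Require Import fsbigop reals complex.

Set Implicit Arguments.
Unset Strict Implicit.
Unset Printing Implicit Defensive.

Import Order.TTheory GRing.Theory Num.Theory.
Local Open Scope classical_set_scope.
Local Open Scope ring_scope.

(** * Subspaces and finitely supported sums *)

Section Subspaces.
Variables (K : fieldType) (V : lmodType K).
Implicit Types (A B : set V) (u v : V).

Lemma is_subspaceD A u v : is_subspace A -> A u -> A v -> A (u + v).
Proof. by move=> [_ Al] Au Av; rewrite -[u]scale1r; exact: Al. Qed.

Lemma is_subspaceZ A a u : is_subspace A -> A u -> A (a *: u).
Proof. by move=> [A0 Al] Au; rewrite -[_ *: _]addr0; exact: Al. Qed.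

Lemma is_subspaceB A u v : is_subspace A -> A u -> A v -> A (u - v).
Proof.
by move=> sA Au Av; rewrite -scaleN1r; apply: is_subspaceD => //; exact: is_subspaceZ.
Qed.

Lemma is_subspaceI A B : is_subspace A -> is_subspace B -> is_subspace (A `&` B).
Proof.
move=> [A0 Al] [B0 Bl]; split=> // a u v [Au Bu] [Av Bv].
by split; [exact: Al|exact: Bl].
Qed.

Lemma is_subspace_sum_set A B :
  is_subspace A -> is_subspace B -> is_subspace (sum_set A B).
Proof.
move=> [A0 Al] [B0 Bl]; split; first by exists 0 => //; exists 0; rewrite ?addr0.
move=> a _ _ [u Au [v Bv <-]] [u' Au' [v' Bv' <-]].
exists (a *: u + u'); first exact: Al.
by exists (a *: v + v'); [exact: Bl|rewrite scalerDr addrACA].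
Qed.

Lemma span_sub A B : is_subspace B -> A `<=` B -> Defs.span A `<=` B.
Proof. by move=> sB AB u; apply. Qed.

Lemma is_subspace_preimage (W : lmodType K) (f : V -> W) (B : set W) :
  linear f -> is_subspace B -> is_subspace [set v | B (f v)].
Proof.
move=> fl [B0 Bl]; split=> [|a u v Bu Bv] /=; last by rewrite fl; exact: Bl.
by have := fl (-1) 0 0; rewrite !scaleN1r !addNr => ->.
Qed.

Section FiniteSupport.
Variables (I : choiceType) (A : I -> set V).
Hypothesis sA : forall i, is_subspace (A i).

Let supp (f : I -> V) : {fset I} := fset_set [set i | f i <> 0].

Let out_supp f i : finite_set [set i | f i <> 0] -> i \notin supp f -> f i = 0.
Proof.
by move=> ff; rewrite /supp in_fset_set // => /negP; rewrite inE /= => /contrapT.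
Qed.

Lemma fsbig_lin (f g : I -> V) (a : K) :
  finite_set [set i | f i <> 0] -> finite_set [set i | g i <> 0] ->
  \sum_(i \in [set: I]) (a *: f i + g i) =
  a *: (\sum_(i \in [set: I]) f i) + \sum_(i \in [set: I]) g i.
Proof.
move=> ff fg; pose r := (supp f `|` supp g)%fset.
have rf i : i \notin r -> f i = 0.
  by rewrite in_fsetU negb_or => /andP[+ _]; exact: out_supp.
have rg i : i \notin r -> g i = 0.
  by rewrite in_fsetU negb_or => /andP[_]; exact: out_supp.
rewrite !(@fsbigTE _ _ _ _ r) //; last first.
  by move=> i ri; rewrite rf // rg // scaler0 addr0.
by rewrite big_split /= scaler_sumr.
Qed.

Lemma finsupp_in_lin (f g : I -> V) (a : K) :
  finsupp_in A f -> finsupp_in A g -> finsupp_in A (fun i => a *: f i + g i).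
Proof.
move=> [ff Af] [fg Ag]; split=> [|i]; last by have [_] := sA i; apply.
have /(sub_finite_set _) : finite_set ([set i | f i <> 0] `|` [set i | g i <> 0]).
  by rewrite finite_setU.
apply=> i /= h; case: (pselect (f i = 0)) => [fi|]; last by left.
by right => gi; apply: h; rewrite fi gi scaler0 addr0.
Qed.

(** Allows membership in a possibly infinite sum of subspaces to be checked on spanning elements, as
    in [ad_finsupp_sum]. *)
Lemma is_subspace_finsupp_sums :
  is_subspace [set w | exists2 f, finsupp_in A f & w = \sum_(i \in [set: I]) f i].
Proof.
split=> [|a _ _ [f fA ->] [g gA ->]].
  exists (fun _ => 0); last by rewrite fsbig1.
  split=> [|i]; last by have [] := sA i.
  by rewrite (_ : [set _ | _] = set0) //; apply/seteqP; split=> i /=.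
exists (fun i => a *: f i + g i); first exact: finsupp_in_lin.
by case: fA gA => ff _ [fg _]; rewrite fsbig_lin.
Qed.

Lemma is_subspace_fsbig (B : set V) (f : I -> V) : is_subspace B ->
  finite_set [set i | f i <> 0] -> (forall i, B (f i)) ->
  B (\sum_(i \in [set: I]) f i).
Proof.
move=> sB ff Bf; rewrite (@fsbigTE _ _ _ _ (supp f)) => [|i]; last exact: out_supp.
by apply: (big_ind B) => [|u v|//]; [case: sB|exact: is_subspaceD].
Qed.

Definition single (j : I) (w : V) (i : I) : V := if i == j then w else 0.

Lemma finsupp_in_single j w : A j w -> finsupp_in A (single j w).
Proof.
move=> Aw; split=> [|i]; last first.
  by rewrite /single; case: eqP => [->//|_]; have [] := sA i.
apply: (sub_finite_set _ (finite_set1 j)) => i /=.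
by rewrite /single; case: eqP.
Qed.

Lemma fsbig_single j w : \sum_(i \in [set: I]) single j w i = w.
Proof.
rewrite (@fsbigTE _ _ _ _ [fset j]%fset) ?big_seq_fset1 /single ?eqxx //.
by move=> i; rewrite in_fset1 => /negbTE->.
Qed.

End FiniteSupport.
End Subspaces.

(** Isolates one term of a finitely supported sum of maps by a projection [h] that kills the others;
    [Der_deg_independent] takes for [h] the projection to a component. *)
Lemma fsbig_component (K : fieldType) (T : Type) (V W : lmodType K)
    (I : choiceType) (f : I -> T -> V) (v : T) (h : V -> W) (j : I) :
  finite_set [set i | f i <> 0] -> linear h ->
  (forall i, i != j -> h (f i v) = 0) ->
  h ((\sum_(i \in [set: I]) f i) v) = h (f j v).
Proof.
move=> ff hl h0; pose hL := GRing.isLinear.Build _ _ _ _ h hl.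
pose H : {linear V -> W} := HB.pack h hL.
(* The index [j] is added to the support so that its term can be extracted even when [f j] is
   zero. *)
have fr i : i \notin (j |` fset_set [set i | f i <> 0])%fset -> f i = 0.
  rewrite in_fset1U negb_or in_fset_set // => /andP[_ /negP].
  by rewrite inE /= => /contrapT.
rewrite (fsbigTE _ _ fr) fct_sumE (big_fsetD1 j) ?in_fset1U ?eqxx //=.
rewrite -[LHS]/(H _) linearD linear_sum /= big_seq big1 ?addr0 // => i.
by rewrite in_fsetD1 => /andP[ij _]; exact: h0.
Qed.

(** * Derivations and inner derivations of an arbitrary Lie superalgebra *)

Section Derivations.
Variables (K : fieldType) (L : lieSuperalgType K).

Lemma is_subspace_superpart e : is_subspace (@superpart K L e).
Proof. by have [] := @superpart_direct K L; case: e. Qed.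

Lemma superpart_split (x : L) :
  exists x0 x1, [/\ superpart false x0, superpart true x1 & x = x0 + x1].
Proof.
have [_ _ /seteqP[+ _] _] := @superpart_direct K L.
by move=> /(_ x I)[x0 ? [x1 ? <-]]; exists x0, x1.
Qed.

Lemma is_subspace_Der_homogeneous e : is_subspace (@Der_homogeneous K L e).
Proof.
have lie0l (y : L) : lie 0 y = 0.
  by have := lie_linearl y (-1) 0 0; rewrite !scaleN1r !addNr.
have lie0r (y : L) : lie y 0 = 0.
  by have := lie_linearr y (-1) 0 0; rewrite !scaleN1r !addNr.
have fun0 (y : L) : (0 : L -> L) y = 0 by [].
split=> [|a D D' [Dl Dp Dd] [Dl' Dp' Dd']]; split.
- by move=> a u v; rewrite !fun0 scaler0 addr0.
- by move=> d x _; have [] := is_subspace_superpart (d (+) e).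
- by move=> d d' x y _ _; rewrite !fun0 lie0l lie0r scaler0 addr0.
- move=> b u v; rewrite !fctE Dl Dl' !scalerDr !scalerA [b * a]mulrC.
  by rewrite addrACA.
- move=> d x xd; rewrite !fctE.
  by have [_] := is_subspace_superpart (d (+) e); apply; [exact: Dp|exact: Dp'].
- move=> d d' x y xd yd'; rewrite !fctE (Dd _ _ _ _ xd yd') (Dd' _ _ _ _ xd yd').
  rewrite lie_linearl lie_linearr !scalerDr !scalerA [a * _]mulrC.
  by rewrite addrACA.
Qed.

Lemma is_subspace_Der : is_subspace (Der L).
Proof. by apply: is_subspace_sum_set; exact: is_subspace_Der_homogeneous. Qed.

Lemma Der_homogeneous_sub e : @Der_homogeneous K L e `<=` Der L.
Proof.
move=> D hD; have [D0 _] := is_subspace_Der_homogeneous (~~ e).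
case: e hD D0 => hD D0; first by exists 0 => //; exists D; rewrite ?add0r.
by exists D => //; exists 0; rewrite ?addr0.
Qed.

Lemma Der_linear (D : L -> L) : Der L D -> linear D.
Proof.
move=> [D0 [D0l _ _] [D1 [D1l _ _] <-]] a u v.
by rewrite !fctE D0l D1l scalerDr addrACA.
Qed.

(** The super Jacobi identity, read as a signed derivation rule. *)
Lemma lie_Der_homogeneous e (z : L) : superpart e z -> @Der_homogeneous K L e (lie z).
Proof.
move=> ze; split=> [|d x xd|d d' x y xd yd]; first exact: lie_linearr.
- by rewrite addbC; exact: lie_superpart.
- by rewrite (lie_super_jacobi _ _ _ _ _ _ ze xd yd).
Qed.

Lemma lieD (z z' : L) : lie (z + z') = lie z + lie z' :> (L -> L).
Proof.
by apply/funext => y; rewrite !fctE -[z]scale1r (lie_linearl y 1 z z') !scale1r.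
Qed.

Lemma is_subspace_lie (S : set (L -> L)) :
  is_subspace S -> is_subspace [set z | S (lie z)].
Proof.
move=> [S0 Sl]; split=> [|a z z' Sz Sz'] /=.
  rewrite (_ : lie 0 = 0) //; apply/funext => y; rewrite -[RHS]/(0 : L).
  by have := lie_linearl y (-1) 0 0; rewrite !scaleN1r !addNr.
rewrite (_ : lie _ = a *: lie z + lie z') //; first exact: Sl.
by apply/funext => y; rewrite !fctE lie_linearl.
Qed.

Lemma ad_sub_Der : ad L `<=` Der L.
Proof.
move=> _ [z _ <-]; have [z0 [z1 [h0 h1 ->]]] := superpart_split z.
by rewrite lieD; apply: (is_subspaceD is_subspace_Der);
  apply: Der_homogeneous_sub; apply: lie_Der_homogeneous; eassumption.
Qed.

Lemma is_subspace_ad : is_subspace (ad L).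
Proof.
split=> [|a _ _ [z _ <-] [z' _ <-]].
  exists 0 => //; apply/funext => y; rewrite -[RHS]/(0 : L).
  by have := lie_linearl y (-1) 0 0; rewrite !scaleN1r !addNr.
by exists (a *: z + z') => //; apply/funext => y; rewrite !fctE lie_linearl.
Qed.

End Derivations.

(** * The operators x + d/dt on polynomials *)

Section Polynomials.
Variable K : numFieldType.
Implicit Types (p q : {poly K}) (x : K).

Lemma poly_lin_ind (P : {poly K} -> Prop) :
  P 0 -> (forall a p q, P p -> P q -> P (a *: p + q)) -> (forall n, P 'X^n) ->
  forall p, P p.
Proof.
move=> P0 Pl PX p; rewrite -[p]coefK poly_def.
apply: (big_ind P) => // [u v Pu Pv|i _]; first by rewrite -[u]scale1r; exact: Pl.
by rewrite -[_ *: _]addr0; exact: Pl.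
Qed.

(** For [x = 0] a scaled antiderivative works; otherwise preimages of the powers of t are built by
    induction on the exponent. *)
Lemma scale_addr_deriv_surj x p : exists q, x *: q + q^`() = p.
Proof.
move: p; apply: poly_lin_ind => [|a p q [p' <-] [q' <-]|n].
- by exists 0; rewrite scaler0 deriv0 addr0.
- by exists (a *: p' + q'); rewrite derivD derivZ -!mul_polyC; ring.
have [->|x0] := eqVneq x 0.
  exists (n.+1%:R^-1 *: 'X^(n.+1)); rewrite scale0r add0r derivZ derivXn /= -scaler_nat.
  by rewrite scalerA mulVf ?scale1r // pnatr_eq0.
elim: n => [|n [q qE]].
  by exists (x^-1%:P); rewrite derivC addr0 -mul_polyC -polyCM divff.
(* Applied to ['X^(n.+1)], the operator leaves the extra term (n+1) ['X^n]; subtracting n+1 times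
   the preimage [q] of ['X^n] cancels it. *)
exists (x^-1 *: ('X^(n.+1) - n.+1%:R *: q)).
rewrite derivZ derivB derivZ derivXn /= -scaler_nat -qE.
rewrite !scalerA divff // scale1r -!mul_polyC.
have hx : x%:P * x^-1%:P = 1 :> {poly K} by rewrite -polyCM divff.
rewrite -[X in _ = X]addr0; apply/eqP; rewrite -subr_eq0; apply/eqP.
transitivity ((n.+1%:R)%:P * q * (x%:P * x^-1%:P - 1)); first by ring.
by rewrite hx subrr mulr0.
Qed.

(** A nonzero [q] has the same size as [x *: q], whereas its derivative is strictly smaller. *)
Lemma scale_addr_deriv_inj x q : x != 0 -> x *: q + q^`() = 0 -> q = 0.
Proof.
move=> x0 h; apply/eqP; apply: contraT => q0.
have := lt_size_deriv q0; have /eqP := h.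
rewrite addr_eq0 => /eqP/(congr1 (size \o polyseq))/=.
by rewrite size_polyN size_scale // => ->; rewrite ltnn.
Qed.

(** The hypothesis turns F(p') into (y - x + d/dt) F(p). By induction on n, the image of ['X^n] is
    then killed by the injective operator (y - x) + d/dt. *)
Lemma intertwiner_eq0 (F : {poly K} -> {poly K}) x y : linear F -> x != y ->
  (forall p, F (x *: p + p^`()) = y *: F p + (F p)^`()) -> forall p, F p = 0.
Proof.
move=> Fl xy; pose Fb := GRing.isLinear.Build _ _ _ _ F Fl.
pose G : {linear {poly K} -> {poly K}} := HB.pack F Fb.
rewrite -[F]/(G : _ -> _); move: G => G {Fb Fl F} GE.
have GD p : G p^`() = (y - x) *: G p + (G p)^`().
  have := GE p; rewrite linearD linearZ /= => /(canRL (addKr _)) ->.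
  by rewrite scalerBl addrA [- _ + _]addrC.
apply: poly_lin_ind => [|a p q Gp Gq|]; first by rewrite linear0.
  by rewrite linearP Gp Gq scaler0 addr0.
have yx : y - x != 0 by rewrite subr_eq0 eq_sym.
elim=> [|n IHn]; apply: (scale_addr_deriv_inj yx); rewrite -GD.
  by rewrite derivC linear0.
by rewrite derivXn /= linearMn IHn mul0rn.
Qed.

End Polynomials.

(** * Polynomial components of elements of the algebra *)

Section Components.
Variables (K : numFieldType) (Gamma : zmodClosed K) (s : K).
Notation SV := (SV Gamma s).
Notation sv_poly := (sv_poly Gamma s).
Notation sv_valid := (sv_valid Gamma s).
Implicit Types (u v : SV) (p q : {poly K}) (x y : K) (a b : bool).

Lemma sv_lin_ind (P : SV -> Prop) :
  P 0 -> (forall c u v, P u -> P v -> P (c *: u + v)) ->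
  (forall b x i, sv_valid b x -> P (sv_poly b x 'X^i)) -> forall u, P u.
Proof.
move=> P0 Pl PX u; have [_ _ /seteqP[+ _] _] := sv_part_direct Gamma s.
move=> /(_ u I)[u0 h0 [u1 h1 <-]]; rewrite -[u0]scale1r.
by apply: (Pl); [move: u0 h0|move: u1 h1]; exact: (sv_part_poly P0 Pl (@PX _)).
Qed.

(** Left inverse of [sv_poly b y] at valid indices; it turns statements about one component into
    statements about polynomials. *)
Definition sv_comp b y : SV -> {poly K} :=
  fglift (fun k : sv_index Gamma s =>
    if (val k).1 == (b, y) then 'X^((val k).2) else 0).

Lemma sv_comp_linear b y : linear (sv_comp b y).
Proof. exact: fglift_linear. Qed.

HB.instance Definition _ b y := GRing.isLinear.Build K SV {poly K} _
  (sv_comp b y) (sv_comp_linear b y).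
HB.instance Definition _ b y := GRing.isLinear.Build K {poly K} SV _
  (sv_poly b y) (sv_poly_linear Gamma s b y).
HB.instance Definition _ u := GRing.isLinear.Build K SV SV _
  (@sv_bracket K Gamma s u) (sv_bracket_linearr u).

Lemma sv_comp_poly b y a x p : sv_valid a x ->
  sv_comp b y (sv_poly a x p) = if (a, x) == (b, y) then p else 0.
Proof.
move=> hx; move: p; apply: poly_lin_ind => [|c p q Hp Hq|i].
- by rewrite !linear0 if_same.
- by rewrite sv_poly_linear sv_comp_linear Hp Hq; case: ifP; rewrite ?scaler0 ?addr0.
rewrite sv_polyXn sv_symE.
by rewrite /sv_comp liftU scale1r SubK.
Qed.

Lemma sv_comp_coeff (k : sv_index Gamma s) u :
  (sv_comp (val k).1.1 (val k).1.2 u)`_((val k).2) = coeff k u.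
Proof.
elim/freeg_ind_dom0: u => [|c l u _ _ IHu]; first by rewrite linear0 coef0 coeff0.
rewrite linearD /= coefD IHu coeffD coeffU; congr (_ + _).
rewrite /sv_comp liftU coefZ -val_eqE; congr (_ * _).
case: k l {IHu} => -[[b y] i] hk [[[a x] j] hl] /=.
rewrite -[RHS]/((((a, x) == (b, y)) && (j == i))%:R).
by case: ((a, x) == (b, y)); rewrite ?coef0 ?coefXn //= eq_sym.
Qed.

Lemma sv_comp_eq0 u : (forall b y, sv_valid b y -> sv_comp b y u = 0) -> u = 0.
Proof.
move=> h; apply/eqP/freeg_eqP => k; rewrite coeff0 -sv_comp_coeff h ?coef0 //.
by case: k => -[[b y] i] /= ; rewrite sv_validE.
Qed.

Lemma sv_part_comp b u a y : sv_part b u -> a != b -> sv_comp a y u = 0.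
Proof.
move=> + ab; move: u; apply: sv_part_poly => [|c u v Hu Hv|x i hx].
- by rewrite linear0.
- by rewrite sv_comp_linear Hu Hv scaler0 addr0.
by rewrite sv_comp_poly // -pair_eqE /= eq_sym (negbTE ab).
Qed.

Lemma sv_part_eq_poly b u x : sv_part b u ->
  (forall y, y != x -> sv_comp b y u = 0) -> u = sv_poly b x (sv_comp b x u).
Proof.
move=> ub uy; apply/eqP; rewrite -subr_eq0; apply/eqP; apply: sv_comp_eq0 => a y ay.
rewrite linearB /=; have [E|ab] := eqVneq a b; last first.
  by rewrite (sv_part_comp y ub) //
    (sv_part_comp y (@sv_poly_part K Gamma s b x _)) ?subrr.
subst a; have [E|yx] := eqVneq y x; first by subst y; rewrite sv_comp_poly // eqxx subrr.
rewrite uy // sub0r; have [bx|bx] := boolP (sv_valid b x).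
  by rewrite sv_comp_poly // -pair_eqE /= [x == y]eq_sym (negbTE yx) andbF oppr0.
by rewrite sv_poly_invalid // linear0 oppr0.
Qed.

Lemma sv_valid0 : sv_valid false 0.
Proof. by rewrite /Defs.sv_valid !inE /= subr0 rpred0. Qed.

(** Since L_0(p) is even of degree 0, it acts on each component separately. *)
Lemma sv_comp_bracketL0 b y p u :
  sv_comp b y (sv_bracket (sv_poly false 0 p) u) =
  sv_poly_bracket false b 0 y p (sv_comp b y u).
Proof.
have sB0 a : sv_poly_bracket false a 0 y p 0 = 0.
  by have := sv_poly_bracket_linearr false a 0 y p (-1) 0 0; rewrite !scaleN1r !addNr.
move: u; apply: sv_lin_ind => [|c u v Hu Hv|a x i hx].
- by rewrite !linear0 sB0.
- by rewrite sv_bracket_linearr !sv_comp_linear Hu Hv sv_poly_bracket_linearr.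
rewrite sv_bracket_poly_valid ?sv_valid0 // addFb add0r !sv_comp_poly //.
by case: eqP => [[-> ->]|]; rewrite ?sB0.
Qed.

Lemma sv_poly_bracket1 b y q : sv_poly_bracket false b 0 y 1 q = y *: q + q^`().
Proof.
by case: b; rewrite /= derivC !mul1r ?mul0r ?scaler0 subr0 // subr0.
Qed.

(** Surjectivity of x + d/dt on every component; this supplies the first inner correction. *)
Lemma sv_part_bracket_surj e u :
  sv_part e u -> exists2 z, sv_part e z & sv_bracket (sv_poly false 0 1) z = u.
Proof.
move: u; apply: sv_part_poly => [|c u v [u' hu <-] [v' hv <-]|x i hx].
- by exists 0; [exact: sv_part0|rewrite linear0].
- by exists (c *: u' + v'); [exact: sv_part_lin|rewrite sv_bracket_linearr].
have [q qE] := scale_addr_deriv_surj x 'X^i.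
exists (sv_poly e x q); first exact: sv_poly_part.
by rewrite sv_bracket_poly_valid ?sv_valid0 // sv_poly_bracket1 qE add0r.
Qed.

End Components.

Lemma deriv_eq0_polyC (K : numFieldType) (p : {poly K}) : p^`() = 0 -> p = (p`_0)%:P.
Proof.
move=> h; apply/polyP => -[|i]; rewrite coefC //=.
move/polyP/(_ i): h; rewrite coef_deriv coef0 => /eqP.
by rewrite mulrn_eq0 /= => /eqP.
Qed.

(** * Homogeneous derivations that kill L_0(1), and the scalars of even ones *)

Section NormalizedDerivations.
Variables (K : numFieldType) (Gamma : zmodClosed K) (s : K).
Notation SV := (SV Gamma s).
Notation sv_poly := (sv_poly Gamma s).
Notation sv_valid := (sv_valid Gamma s).
Implicit Types (u v : SV) (p q : {poly K}) (x y : K) (a b : bool).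

Lemma sv_bracketZl c u v : sv_bracket (c *: u) v = c *: sv_bracket u v.
Proof. by rewrite -[c *: u]addr0 sv_bracket_linearl sv_bracket0l addr0. Qed.

Lemma sv_bracketZr c u v : sv_bracket u (c *: v) = c *: sv_bracket u v.
Proof. by rewrite -[c *: v]addr0 sv_bracket_linearr sv_bracket0r addr0. Qed.

(** The operator t (x + d/dt) up to a constant that depends only on parity: 1 on L and 1/2 on G.
    This constant separates even from odd derivations. *)
Lemma sv_poly_bracketX b x q : sv_poly_bracket false b 0 x 'X q =
  'X * (x *: q + q^`()) - (if b then 2^-1 else 1) *: q.
Proof. by case: b; rewrite /= derivX ?mul0r ?subr0 -!mul_polyC; ring. Qed.

Section Homogeneous.
Variables (e : bool) (D : SV -> SV).
Hypothesis hD : Der_homogeneous e D.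

Let Dl : linear D. Proof. by have [] := hD. Qed.

Let D0 : D 0 = 0.
Proof. by have := Dl (-1) 0 0; rewrite !scaleN1r !addNr. Qed.

Let Dp b u : sv_part b u -> sv_part (b (+) e) (D u).
Proof. by have [_ + _] := hD; apply. Qed.

Let Db a b u v : sv_part a u -> sv_part b v -> D (sv_bracket u v) =
  sv_bracket (D u) v + (-1) ^+ (e && a) *: sv_bracket u (D v).
Proof. by have [_ _] := hD; apply. Qed.

Let Db0 p b v : D (sv_poly false 0 p) = 0 -> sv_part b v ->
  D (sv_bracket (sv_poly false 0 p) v) = sv_bracket (sv_poly false 0 p) (D v).
Proof.
move=> Dp0 bv; rewrite (Db (@sv_poly_part K Gamma s false 0 p) bv) Dp0.
by rewrite sv_bracket0l add0r andbF scale1r.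
Qed.

(* The operator on polynomials induced by [D] between the degree [x] components;
   when [D] kills L_0(1) it determines [D], see [Der_sv_poly] *)
Definition Der_op b x p := sv_comp (b (+) e) x (D (sv_poly b x p)).
Local Notation E := Der_op.

Lemma Der_op_linear b x : linear (E b x).
Proof. by move=> c p q; rewrite /Der_op sv_poly_linear Dl sv_comp_linear. Qed.

Lemma Der_op_bracket b x p q : D (sv_poly false 0 p) = 0 -> sv_valid b x ->
  E b x (sv_poly_bracket false b 0 x p q) =
  sv_poly_bracket false (b (+) e) 0 x p (E b x q).
Proof.
move=> Dp0 bx; rewrite /Der_op -sv_comp_bracketL0.
rewrite -(Db0 Dp0 (@sv_poly_part K Gamma s b x q)).
by rewrite sv_bracket_poly_valid ?sv_valid0 // add0r.
Qed.

Hypothesis DL1 : D (sv_poly false 0 1) = 0.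

Lemma Der_op_shift b x p : sv_valid b x ->
  E b x (x *: p + p^`()) = x *: E b x p + (E b x p)^`().
Proof. by move=> bx; rewrite -(sv_poly_bracket1 b) Der_op_bracket // sv_poly_bracket1. Qed.

(** As [D] commutes with ad L_0(1), its part from degree x to degree y intertwines x + d/dt with y +
    d/dt, so [intertwiner_eq0] applies. *)
Lemma Der_comp_eq0 b x a y p : y != x -> sv_comp a y (D (sv_poly b x p)) = 0.
Proof.
move=> yx; have [bx|bx] := boolP (sv_valid b x); last first.
  by rewrite sv_poly_invalid // D0 linear0.
apply: (@intertwiner_eq0 _ (fun p => sv_comp a y (D (sv_poly b x p))) x y).
- by move=> c q r; rewrite sv_poly_linear Dl sv_comp_linear.
- by rewrite eq_sym.
move=> q /=; rewrite -(sv_poly_bracket1 a y) -sv_comp_bracketL0.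
rewrite -(Db0 DL1 (@sv_poly_part K Gamma s b x q)).
by rewrite sv_bracket_poly_valid ?sv_valid0 // add0r sv_poly_bracket1.
Qed.

Lemma Der_sv_poly b x p : D (sv_poly b x p) = sv_poly (b (+) e) x (E b x p).
Proof.
apply: sv_part_eq_poly => [|y yx]; first by apply: Dp; exact: sv_poly_part.
exact: Der_comp_eq0.
Qed.

(** At the constant 1 the shift relation reads x E(1) = x E(1) + E(1)', so the derivative of E(1)
    vanishes. *)
Lemma Der_op1_const b x : sv_valid b x -> E b x 1 = ((E b x 1)`_0)%:P.
Proof.
move=> bx; apply: deriv_eq0_polyC; apply: (addrI (x *: E b x 1)).
rewrite -Der_op_shift // derivC addr0 addr0.
have := Der_op_linear b x x 1 0; rewrite addr0 => ->.
by rewrite /E sv_poly0 D0 linear0 addr0.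
Qed.

End Homogeneous.

(** Compares the action of L_0(t) before and after [D]. The parity constants of [sv_poly_bracketX]
    cancel for even [D] and differ by 1/2 up to sign for odd [D]. *)
Lemma Der_op_bracketX e D b x q : Der_homogeneous e D ->
  D (sv_poly false 0 'X) = 0 -> sv_valid b x ->
  Der_op e D b x ('X * (x *: q + q^`())) =
  'X * (x *: Der_op e D b x q + (Der_op e D b x q)^`())
  + ((if b then 2^-1 else 1) - (if b (+) e then 2^-1 else 1)) *: Der_op e D b x q.
Proof.
move=> hD DX bx; have := Der_op_bracket hD q DX bx.
rewrite !sv_poly_bracketX -scaleNr addrC (Der_op_linear hD) => /(canRL (addKr _)) ->.
by rewrite -!mul_polyC rmorphB /= rmorphN /=; ring.
Qed.

(** Every polynomial is (x + d/dt) q for some q, so commuting with both x + d/dt and t (x + d/dt)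
    implies commuting with t. *)
Lemma Der_op_mulX D b x p : Der_homogeneous false D -> D (sv_poly false 0 1) = 0 ->
  D (sv_poly false 0 'X) = 0 -> sv_valid b x ->
  Der_op false D b x ('X * p) = 'X * Der_op false D b x p.
Proof.
move=> hD D1 DX bx; have [q <-] := scale_addr_deriv_surj x p.
by rewrite Der_op_bracketX // Der_op_shift // addbF subrr scale0r addr0.
Qed.

Definition Der_weight (D : SV -> SV) b x : K := (Der_op false D b x 1)`_0.

(** A linear operator that commutes with t is multiplication by its value at 1, here a constant by
    [Der_op1_const]. *)
Lemma Der_even_scalar D b x p : Der_homogeneous false D ->
  D (sv_poly false 0 1) = 0 -> D (sv_poly false 0 'X) = 0 -> sv_valid b x ->
  D (sv_poly b x p) = Der_weight D b x *: sv_poly b x p.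
Proof.
move=> hD D1 DX bx; rewrite (Der_sv_poly hD D1) addbF -sv_polyZ.
congr (Defs.sv_poly _ _ _ _).
move: p; apply: poly_lin_ind => [|c p q Hp Hq|].
- have := Der_op_linear hD b x (-1) 0 0; rewrite !scaleN1r !addNr => ->.
  by rewrite scaler0.
- by rewrite (Der_op_linear hD) Hp Hq scalerDr !scalerA [c * _]mulrC.
elim=> [|n IHn]; first by rewrite Der_op1_const // /Der_weight alg_polyC.
by rewrite exprS Der_op_mulX // IHn scalerAr.
Qed.

Lemma sv_poly_bracket_neq0 a b x y : exists p q, sv_poly_bracket a b x y p q != 0.
Proof.
have coef0_neq p : p`_0 != 0 -> p != 0 by apply: contraNneq => ->; rewrite coef0.
have half_neq0 : 2^-1 != 0 :> K by rewrite invr_eq0 pnatr_eq0.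
(* With these witnesses the constant coefficient of the bracket is 1, 1/2 or 2, whatever [x] and [y]
   are. *)
exists 1, (if a && b then 1 else 'X); apply: coef0_neq.
by case: a; case: b; rewrite /= ?derivX ?derivC !(mul1r, mul0r, mulr0, mulr1)
  !(coefD, coefN, coefZ, coefX, coef1, coef0) /= ?(mulr0, add0r, mulr1, subr0, sub0r)
  ?opprK ?oner_eq0 ?pnatr_eq0.
Qed.

(** The only case beyond [sv_valid_add] is a sum of two odd degrees: it lies in 2s + Gamma, which is
    Gamma by [s2]. *)
Lemma sv_validD (s2 : 2 * s \in Gamma) a b x y :
  sv_valid a x -> sv_valid b y -> sv_valid (a (+) b) (x + y).
Proof.
have [/andP[-> ->]|/negbTE ab ax bY] := boolP (a && b); last first.
  by apply: sv_valid_add; rewrite ?ab.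
rewrite /Defs.sv_valid !inE /= => ax bY.
have -> : x + y - 0 = (x - s) + (y - s) + 2 * s by ring.
by apply: rpredD => //; exact: rpredD.
Qed.

(** A nonzero bracket of the two components is scaled by the weight of its own component and, by the
    derivation rule, by the sum of the two weights. *)
Lemma Der_weightD (s2 : 2 * s \in Gamma) D a b x y : Der_homogeneous false D ->
  D (sv_poly false 0 1) = 0 -> D (sv_poly false 0 'X) = 0 ->
  sv_valid a x -> sv_valid b y ->
  Der_weight D (a (+) b) (x + y) = Der_weight D a x + Der_weight D b y.
Proof.
move=> hD D1 DX ax bY; have abxy := sv_validD s2 ax bY.
have [p [q pq0]] := sv_poly_bracket_neq0 a b x y.
have [_ _ Dd] := hD.
have : D (sv_bracket (sv_poly a x p) (sv_poly b y q)) =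
    sv_bracket (D (sv_poly a x p)) (sv_poly b y q)
    + 1 *: sv_bracket (sv_poly a x p) (D (sv_poly b y q)).
  exact: Dd (sv_poly_part _ _) (sv_poly_part _ _).
rewrite (Der_even_scalar p hD D1 DX ax) (Der_even_scalar q hD D1 DX bY).
rewrite sv_bracketZl sv_bracketZr scale1r -scalerDl sv_bracket_poly_valid //.
rewrite (Der_even_scalar _ hD D1 DX abxy).
move/eqP; rewrite -subr_eq0 -scalerBl -sv_polyZ.
move=> /eqP/(congr1 (sv_comp (a (+) b) (x + y))).
rewrite sv_comp_poly // eqxx linear0 => /eqP; rewrite scaler_eq0 (negbTE pq0) orbF.
by rewrite subr_eq0 => /eqP.
Qed.
End NormalizedDerivations.

(** * Vanishing of normalized odd derivations *)

Section OddDerivations.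
Variables (K : numFieldType) (Gamma : zmodClosed K) (s : K).
Notation SV := (SV Gamma s).
Notation sv_poly := (sv_poly Gamma s).
Notation sv_valid := (sv_valid Gamma s).
Implicit Types (u v : SV) (p q : {poly K}) (x y : K) (a b : bool).

Lemma sv_valid_parity b c x : s \in Gamma -> sv_valid b x -> sv_valid c x.
Proof.
rewrite /Defs.sv_valid !inE /= => sG.
case: b; case: c => //= xG.
  have -> : x - 0 = x - s + s by ring.
  exact: rpredD.
have -> : x - s = x - 0 - s by ring.
exact: rpredB.
Qed.

Lemma sv_valid_disjoint x : s \notin Gamma ->
  sv_valid false x -> sv_valid true x -> False.
Proof.
rewrite /Defs.sv_valid !inE /= => /negP sG xG xsG; apply: sG.
have -> : s = x - 0 - (x - s) by ring.
exact: rpredB.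
Qed.

(** The minus sign arises from moving the odd [D] past the odd G_0(p); [s \in Gamma] makes both
    parities occur in degrees 0 and x. *)
Lemma Der_op_bracketG D b x p q : s \in Gamma -> Der_homogeneous true D ->
  D (sv_poly false 0 1) = 0 -> D (sv_poly true 0 p) = 0 -> sv_valid b x ->
  Der_op true D (~~ b) x (sv_poly_bracket true b 0 x p q) =
  - sv_poly_bracket true (~~ b) 0 x p (Der_op true D b x q).
Proof.
move=> sG hD D1 Dp0 bx; have [_ _ Dd] := hD.
have V c : sv_valid c x by exact: sv_valid_parity bx.
have V0 : sv_valid true 0 by apply: (sv_valid_parity true sG (sv_valid0 Gamma s)).
have : D (sv_bracket (sv_poly true 0 p) (sv_poly b x q)) =
    sv_bracket (D (sv_poly true 0 p)) (sv_poly b x q)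
    + (- 1) *: sv_bracket (sv_poly true 0 p) (D (sv_poly b x q)).
  exact: Dd (sv_poly_part _ _) (sv_poly_part _ _).
rewrite Dp0 sv_bracket0l add0r (Der_sv_poly hD D1 b) addbT.
rewrite !sv_bracket_poly_valid // !addTb !add0r negbK => H.
rewrite /Der_op H addbT negbK -sv_polyZ sv_comp_poly // eqxx scaleN1r.
by [].
Qed.

(* With E the operator of D on G_x, F the one on L_x and d = d/dt, brackets with
   G_0(1) and G_0(t) give, for all q,
     2 F(q) = - E((x + d) q) / 2,
     2 F(t q) = E(q) - t E((x + d) q) / 2,
     E(t (x + d) q) / 2 - E(q) = - 2 t F(q);
   eliminating F leaves 5/2 E(q) = 0, and then F = 0 *)
Lemma Der_odd_eq0 D : Der_homogeneous true D ->
  D (sv_poly false 0 1) = 0 -> D (sv_poly false 0 'X) = 0 -> D = (fun=> 0).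
Proof.
move=> hD D1 DX; have [Dl _ _] := hD.
have D0 : D 0 = 0 by have := Dl (-1) 0 0; rewrite !scaleN1r !addNr.
suff DP b x p : sv_valid b x -> D (sv_poly b x p) = 0.
  apply/funext; apply: sv_lin_ind => // [c u v Du Dv|b x i]; last exact: DP.
  by rewrite Dl Du Dv scaler0 addr0.
(* If [s] is outside Gamma, no degree carries both parities, so a degree-preserving odd map has no
   nonzero target. *)
move=> bx; have [sG|sG] := boolP (s \in Gamma); last first.
  rewrite (Der_sv_poly hD D1) addbT sv_poly_invalid //; apply/negP => bx'.
  by case: b bx bx' => bx bx';
    [exact: (sv_valid_disjoint sG bx' bx)|exact: (sv_valid_disjoint sG bx bx')].
have V c : sv_valid c x by exact: sv_valid_parity bx.
have V0 c : sv_valid c 0 by apply: (sv_valid_parity c sG (sv_valid0 Gamma s)).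
rewrite (Der_sv_poly hD D1); set E := Der_op true D.
have El c y : linear (E c y) by exact: Der_op_linear.
have E0 c y : E c y 0 = 0 by rewrite /E /Der_op sv_poly0 D0 linear0.
have EZ c y k r : E c y (k *: r) = k *: E c y r.
  by have := El c y k r 0; rewrite E0 !addr0.
have ED c y q r : E c y (q + r) = E c y q + E c y r.
  by have := El c y 1 q r; rewrite !scale1r.
(* For [x = 0] and [q = 1], [Der_op_bracketX] reduces to 0 = (1/2 - 1) E(1), because E(1) is
   constant. *)
have E1 : E true 0 1 = 0.
  have := Der_op_bracketX 1 hD DX (V0 true); rewrite -/E derivC addr0 scale0r mulr0.
  rewrite E0 (_ : (E true 0 1)^`() = 0); last first.
    by rewrite /E (Der_op1_const hD D1 (V0 true)) derivC.
  rewrite scale0r addr0 mulr0 add0r /=.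
  move/esym/eqP; rewrite scaler_eq0 => /orP[|/eqP//].
  by rewrite subr_eq0 invr_eq1 pnatr_eq1.
(* Here E(t)' = E(1) = 0, so the same relation at [q = 'X] gives E(t) = (1/2 - 1) E(t), that is
   (3/2) E(t) = 0. *)
have EX : E true 0 'X = 0.
  have := Der_op_bracketX 'X hD DX (V0 true).
  rewrite -(Der_op_shift hD D1) // -/E derivX scale0r add0r mulr1 E1 mulr0 add0r /=.
  move/eqP; rewrite -subr_eq0 -[X in X - _]scale1r -scalerBl scaler_eq0.
  case/orP => [|/eqP//]; rewrite opprB addrCA.
  by rewrite (_ : 1 + (1 - 2^-1) = 3 / 2 :> K);
    [rewrite mulf_eq0 invr_eq0 !pnatr_eq0|field].
have G0 : D (sv_poly true 0 1) = 0 by rewrite (Der_sv_poly hD D1) -/E E1 sv_poly0.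
have GX : D (sv_poly true 0 'X) = 0 by rewrite (Der_sv_poly hD D1) -/E EX sv_poly0.

have shiftE c q : x *: E c x q + (E c x q)^`() = E c x (x *: q + q^`()).
  by rewrite /E Der_op_shift.
have B1 q : 2 *: E false x q = - (2^-1 *: E true x (x *: q + q^`())).
  have := Der_op_bracketG q sG hD D1 G0 (V true); rewrite -/E /= EZ mul1r => ->.
  rewrite -shiftE derivC !mul0r !mul1r -!mul_polyC; ring.

have B2 q : 2 *: E false x ('X * q) =
    E true x q - 2^-1 *: ('X * E true x (x *: q + q^`())).
  have := Der_op_bracketG q sG hD D1 GX (V true); rewrite -/E /= EZ => ->.
  by rewrite -shiftE derivX !mul1r -!mul_polyC; ring.
have B3 q : 2^-1 *: E true x ('X * (x *: q + q^`())) - E true x q =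
    - ('X * (2 *: E false x q)).
  have := Der_op_bracketG q sG hD D1 GX (V false); rewrite -/E.
  rewrite (_ : sv_poly_bracket true false 0 x 'X q =
    2^-1 *: ('X * (x *: q + q^`())) + -1 *: q); last first.
    by rewrite /= derivX mul1r -!mul_polyC; ring.
  by rewrite /= ED !EZ scaleN1r => ->; rewrite scalerAr.
have Etrue0 q : E true x q = 0.
  (* [B1] at ['X * q] and [B2] compute the same value; [B3], with [B1] inserted, then eliminates
     [A]. *)
  have := B1 ('X * q); rewrite B2 derivM derivX mul1r.
  rewrite (_ : x *: ('X * q) + _ = 'X * (x *: q + q^`()) + q); last first.
    by rewrite -!mul_polyC; ring.
  rewrite (ED _ _ ('X * _) q); have := B3 q; rewrite B1.
  set A := E true x ('X * _); set S := E true x (_ + _); set Q := E true x q => H3 H2.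
  have : (5 / 2) *: Q = 0; last first.
    by move=> /eqP; rewrite scaler_eq0 mulf_eq0 invr_eq0 !pnatr_eq0 => /eqP.
  have h2 : 2^-1 *: A = Q + 2^-1 *: ('X * S).
    by rewrite -[LHS](subrK Q) H3 mulrN opprK addrC scalerAr.
  move: H2; rewrite scalerDr h2 => /eqP; rewrite -subr_eq0 => /eqP <-.
  by rewrite [5 / 2](_ : _ = 2 + 2^-1) ?scalerDl -?mul_polyC; [ring|field].
case: b {bx}; first by rewrite Etrue0 sv_poly0.
have := B1 p; rewrite Etrue0 scaler0 oppr0 => /eqP.
by rewrite scaler_eq0 pnatr_eq0 => /eqP->; rewrite sv_poly0.
Qed.
End OddDerivations.

(** * Diagonal derivations given by additive functions on Omega *)

Section DiagonalDerivations.
Variables (K : numFieldType) (Gamma : zmodClosed K) (s : K).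
Notation SV := (SV Gamma s).
Notation sv_poly := (sv_poly Gamma s).
Notation sv_valid := (sv_valid Gamma s).
Notation Omega := (Omega Gamma s).
Implicit Types (u v : SV) (p q : {poly K}) (x y : K) (a b : bool).

Lemma sv_valid_Omega b x : sv_valid b x -> exists alpha : Omega, val alpha = x.
Proof.
move=> bx; suff xO : x \in Omega_pred Gamma s by exists (Sub x xO); rewrite SubK.
rewrite inE => B [[B0 BB] GB].
have BD (y z : K) : B y -> B z -> B (y + z).
  move=> By Bz; rewrite -[z]opprK; apply: (BB) => //.
  by rewrite -[- z]add0r; apply: BB.
move: bx; rewrite /Defs.sv_valid inE /= => xG.
rewrite -[x](subrK (if b then s else 0)); apply: BD; first by apply: GB; left.
by case: b {xG} => //; apply: GB; right.
Qed.

(** Because 2s lies in Gamma, the union of Gamma and s + Gamma is already a subgroup, hence contains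
    the generated group Omega. *)
Lemma Omega_valid (s2 : 2 * s \in Gamma) (alpha : Omega) :
  exists b, sv_valid b (val alpha).
Proof.
case: alpha => x /=; rewrite inE => xO.
apply: (xO [set y | exists b, sv_valid b y]); split; first split.
- by exists false; exact: sv_valid0.
- move=> y z [a au] [b bv]; exists (a (+) b); apply: sv_validD => //.
  move: bv; rewrite /Defs.sv_valid !inE /=; case: b => bv.
    have -> : - z - s = - (z - s) - 2 * s by ring.
    by apply: rpredB => //; rewrite rpredN.
  have -> : - z - 0 = - (z - 0) by ring.
  by rewrite rpredN.
- move=> y /= [yG|->]; first by exists false; rewrite /Defs.sv_valid !inE /= subr0.
  by exists true; rewrite /Defs.sv_valid !inE /= subrr rpred0.
Qed.

Section Diagonal.
Variable phi : {additive Omega -> K}.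

Lemma sv_diag_linear : linear (sv_diag phi).
Proof. exact: fglift_linear. Qed.

Lemma sv_diag_poly b (alpha : Omega) p :
  sv_diag phi (sv_poly b (val alpha) p) = phi alpha *: sv_poly b (val alpha) p.
Proof.
have sv_diag0 : sv_diag phi 0 = 0 by exact: fglift0.
move: p; apply: poly_lin_ind => [|c p q Hp Hq|i].
- by rewrite sv_poly0 scaler0.
- by rewrite sv_poly_linear sv_diag_linear Hp Hq scalerDr !scalerA [c * _]mulrC.
by rewrite sv_polyXn sv_diag_sym.
Qed.

Lemma sv_diag_part b u : sv_part b u -> sv_part b (sv_diag phi u).
Proof.
move: u; apply: sv_part_poly => [|c u v Hu Hv|x i bx].
- by rewrite /sv_diag fglift0; exact: sv_part0.
- by rewrite sv_diag_linear; exact: sv_part_lin.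
have [alpha <-] := sv_valid_Omega bx.
by rewrite sv_diag_poly -sv_polyZ; exact: sv_poly_part.
Qed.

Lemma sv_diag_bracket u v :
  sv_diag phi (sv_bracket u v) =
  sv_bracket (sv_diag phi u) v + sv_bracket u (sv_diag phi v).
Proof.
have sv_diag0 : sv_diag phi 0 = 0 by exact: fglift0.
move: u v; apply: sv_lin_ind => [v|c u u' Hu Hu' v|b x i bx].
- by rewrite sv_diag0 !sv_bracket0l sv_diag0 addr0.
- rewrite sv_diag_linear !sv_bracket_linearl sv_diag_linear Hu Hu'.
  by rewrite scalerDr addrACA.
apply: sv_lin_ind => [|c v v' Hv Hv'|a y j ay].
- by rewrite sv_diag0 !sv_bracket0r sv_diag0 addr0.
- rewrite sv_diag_linear !sv_bracket_linearr sv_diag_linear Hv Hv'.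
  by rewrite scalerDr addrACA.
have [alpha aE] := sv_valid_Omega bx; have [beta bE] := sv_valid_Omega ay.
subst x y; rewrite sv_bracket_poly_valid //.
rewrite -[val alpha + val beta]/(val (alpha + beta)) !sv_diag_poly.
by rewrite sv_bracketZl sv_bracketZr sv_bracket_poly_valid // -scalerDl raddfD.
Qed.

Lemma sv_diag_Der_homogeneous : Der_homogeneous false (sv_diag phi).
Proof.
split=> [|d u du|d d' u v _ _]; first exact: sv_diag_linear.
- by rewrite addbF; exact: sv_diag_part.
by rewrite scale1r; exact: sv_diag_bracket.
Qed.

Lemma sv_diag_deg (alpha : Omega) v : sv_deg alpha v -> sv_diag phi v = phi alpha *: v.
Proof.
apply: (@span_sub _ _ _ [set v | sv_diag phi v = phi alpha *: v]) => [|_ [i [|]->]] /=.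
- split=> [|c u w /= Hu Hw] /=; first by rewrite /sv_diag fglift0 scaler0.
  by rewrite sv_diag_linear Hu Hw scalerDr !scalerA [c * _]mulrC.
- exact: sv_diag_sym.
exact: sv_diag_sym.
Qed.

End Diagonal.

Lemma additive_of_fun (f : Omega -> K) : {morph f : u v / u + v} ->
  exists phi : {additive Omega -> K}, phi =1 f.
Proof.
move=> fD; have fB : zmod_morphism f.
  by move=> u v; apply: (addIr (f v)); rewrite -fD !subrK.
pose fA := GRing.isZmodMorphism.Build _ _ f fB.
by exists (HB.pack_for {additive Omega -> K} f fA).
Qed.

Lemma sv_diag_eqP (phi : {additive Omega -> K}) (D : SV -> SV) : linear D ->
  (forall b (alpha : Omega) p, sv_valid b (val alpha) ->
    D (sv_poly b (val alpha) p) = phi alpha *: sv_poly b (val alpha) p) ->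
  D = sv_diag phi.
Proof.
move=> Dl DE; apply/funext; apply: sv_lin_ind => [|c u v Hu Hv|b x i bx].
- by rewrite /sv_diag fglift0; have := Dl (-1) 0 0; rewrite !scaleN1r !addNr.
- by rewrite Dl sv_diag_linear Hu Hv.
by have [alpha aE] := sv_valid_Omega bx; subst x; rewrite sv_diag_poly DE.
Qed.

Lemma Hom_Omega0 : Hom_Omega Gamma s (fun=> 0).
Proof.
have [phi phi0] := additive_of_fun (fun _ _ => esym (addr0 (0 : K))).
exists phi => //; apply/esym/sv_diag_eqP => [k u v|b alpha p _].
  by rewrite scaler0 addr0.
by rewrite phi0 scale0r.
Qed.

End DiagonalDerivations.

(** * Splitting a homogeneous derivation into an inner and a diagonal one *)

Section Splitting.
Variables (K : numFieldType) (Gamma : zmodClosed K) (s : K).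
Notation SV := (SV Gamma s).
Notation sv_poly := (sv_poly Gamma s).
Notation sv_valid := (sv_valid Gamma s).
Notation Omega := (Omega Gamma s).
Implicit Types (u v z : SV) (p q : {poly K}) (x y : K) (a b : bool).

Lemma Der_even_diag (s2 : 2 * s \in Gamma) (D : SV -> SV) : Der_homogeneous false D ->
  D (sv_poly false 0 1) = 0 -> D (sv_poly false 0 'X) = 0 ->
  exists phi : {additive Omega -> K}, D = sv_diag phi.
Proof.
move=> hD D1 DX; pose w := Der_weight D.
have wD a b x y : sv_valid a x -> sv_valid b y -> w (a (+) b) (x + y) = w a x + w b y.
  exact: Der_weightD.
(* When s is in Gamma, [L] and [G] share their degrees; [fE] shows that both
   weights agree *)
pose f (alpha : Omega) := w (~~ (sv_valid false (val alpha))) (val alpha).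
have fE b (alpha : Omega) : sv_valid b (val alpha) -> f alpha = w b (val alpha).
  rewrite /f; have [f0|f0] := boolP (sv_valid false (val alpha)) => //; case: b => //.
    move=> f1; have [sG|/sv_valid_disjoint] := boolP (s \in Gamma); last first.
      by move/(_ _ f0 f1).
    have V0 b : sv_valid b 0 by apply: (sv_valid_parity b sG (sv_valid0 Gamma s)).
    have w00 : w false 0 = 0.
      by apply: (addrI (w false 0)); rewrite -wD // !addr0.
    (* Two odd components of degree 0 bracket into L_0, so twice their weight is the weight of L_0,
       which is zero. *)
    have w10 : w true 0 = 0.
      have := wD true true 0 0 (V0 _) (V0 _); rewrite addr0 w00 -mulr2n => /esym/eqP.
      by rewrite mulrn_eq0 => /eqP.
    by have := wD false true _ _ f0 (V0 true); rewrite w10 !addr0.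
  by rewrite (negbTE f0).
have fD : {morph f : alpha beta / alpha + beta}.
  move=> alpha beta; have [a aP] := Omega_valid s2 alpha.
  have [b bP] := Omega_valid s2 beta.
  by rewrite (fE a alpha) // (fE b beta) // -wD // (fE (a (+) b)) //; exact: sv_validD.
have [phi phiE] := additive_of_fun fD; exists phi.
have [Dl _ _] := hD; apply: sv_diag_eqP => // b alpha p bV.
by rewrite phiE (fE b) // (Der_even_scalar _ hD).
Qed.

Lemma sv_bracket_antisym0 u z : sv_part false u -> sv_bracket z u = - sv_bracket u z.
Proof.
move=> u0; move: z; apply: sv_lin_ind => [|c v w Hv Hw|b x i bx].
- by rewrite sv_bracket0l sv_bracket0r oppr0.
- by rewrite sv_bracket_linearl sv_bracket_linearr Hv Hw scalerN opprD.
rewrite (sv_bracket_super_antisym (@sv_poly_part K Gamma s b x _) u0).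
by rewrite andbF scale1r.
Qed.

Lemma sv_bracket_hom e z : sv_part e z -> Der_homogeneous e (sv_bracket z : SV -> SV).
Proof. exact: (@lie_Der_homogeneous K SV e z). Qed.

Lemma is_subspace_Der_hom e : is_subspace (@Der_homogeneous K SV e).
Proof. exact: is_subspace_Der_homogeneous. Qed.

(** The second inner correction. The polynomial [r] of D(L_0(t)) is constant, since its derivative
    is that of D(L_0(1)) = 0; a constant in degree 0 centralizes L_0(1), and its bracket with L_0(t)
    is a multiple of itself. *)
Lemma exists_sv_bracketX e (D : SV -> SV) : Der_homogeneous e D ->
  D (sv_poly false 0 1) = 0 ->
  exists2 z, sv_part e z & sv_bracket z (sv_poly false 0 1) = 0 /\
    sv_bracket z (sv_poly false 0 'X) = D (sv_poly false 0 'X).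
Proof.
move=> hD D1; have V0 := sv_valid0 Gamma s.
rewrite [D (sv_poly _ _ 'X)](Der_sv_poly hD D1); set r := Der_op _ _ _ _ _.
have r' : r^`() = 0.
  have := Der_op_shift hD D1 'X V0; rewrite !scale0r !add0r derivX -/r => <-.
  by rewrite /Der_op D1 linear0.
(* The factor 2 compensates [G_0(r), L_0(t)] = G_0(r)/2 for constant r. *)
exists (sv_poly e 0 ((if e then 2 else 1) *: r)); first exact: sv_poly_part.
rewrite addFb; have [eV|eV] := boolP (sv_valid e 0); last first.
  by rewrite !(sv_poly_invalid _ eV) !sv_bracket0l.
have dr c : (c *: r)^`() = 0 by rewrite derivZ r' scaler0.
rewrite !sv_bracket_poly_valid // !addbF !addr0; split.
  rewrite (_ : sv_poly_bracket _ _ _ _ _ _ = 0) ?sv_poly0 //.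
  by case: (e); rewrite /= dr derivC
    !(mulr0, mul0r, mulr1, subr0, scale0r, scaler0, oppr0, addr0).
congr (Defs.sv_poly _ _ _ _ _).
case: (e); rewrite /= dr derivX mul0r mulr1 ?mul0r ?subr0
  scale0r add0r ?scale1r ?sub0r //.
by rewrite opprK scalerA mulVf ?scale1r // pnatr_eq0.
Qed.

Lemma Der_homogeneous_decomp (s2 : 2 * s \in Gamma) e (D : SV -> SV) :
  Der_homogeneous e D ->
  exists z (phi : {additive Omega -> K}), D = sv_bracket z + sv_diag phi.
Proof.
move=> hD; have V0 := sv_valid0 Gamma s; have [_ Dp _] := hD.
have L1 := @sv_poly_part K Gamma s false 0 1.
(* The element [z1] solves [L_0(1), z1] = D(L_0(1)); by antisymmetry it is the sum of [D] and ad z1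
   that kills L_0(1). *)
have [z1 z1P z1E] := sv_part_bracket_surj (Dp _ _ L1).
have hD1 := is_subspaceD (is_subspace_Der_hom e) hD (sv_bracket_hom z1P).
have D10 : (D + sv_bracket z1 : SV -> SV) (sv_poly false 0 1) = 0.
  by rewrite addrfctE sv_bracket_antisym0 // z1E subrr.
have [z2 z2P [z2L z2X]] := exists_sv_bracketX hD1 D10.
have hD2 := is_subspaceB (is_subspace_Der_hom e) hD1 (sv_bracket_hom z2P).
move: hD2; set D2 := _ - _ => hD2.
have D21 : D2 (sv_poly false 0 1) = 0.
  by rewrite /D2 !fctE in D10 *; rewrite D10 z2L subr0.
have D2X : D2 (sv_poly false 0 'X) = 0.
  by rewrite /D2 !fctE in z2X *; rewrite z2X subrr.
have [phi D2E] : exists phi : {additive Omega -> K}, D2 = sv_diag phi.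
  move: hD2; case: (e) => hD2; last exact: Der_even_diag.
  have [phi _ phi0] := Hom_Omega0 Gamma s; exists phi.
  by rewrite phi0; exact: Der_odd_eq0.
exists (z2 - z1), phi; rewrite -D2E; apply/funext => v; rewrite /D2 !fctE.
rewrite [sv_bracket (z2 - z1) v](_ : _ = sv_bracket z2 v - sv_bracket z1 v).
  by rewrite [RHS]addrC addrA subrK addrK.
by rewrite -scaleN1r addrC sv_bracket_linearl scaleN1r addrC.
Qed.
End Splitting.

(** * The Omega-grading and the direct sum decompositions *)

Section Grading.
Variables (K : numFieldType) (Gamma : zmodClosed K) (s : K).
Notation SV := (SV Gamma s).
Notation sv_poly := (sv_poly Gamma s).
Notation sv_valid := (sv_valid Gamma s).
Notation Omega := (Omega Gamma s).
Notation Der_deg := (@Der_deg K Gamma s).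
Implicit Types (u v z : SV) (p q : {poly K}) (x y : K) (a b : bool).
Implicit Types (alpha gamma : Omega) (phi : {additive Omega -> K}).

Lemma is_subspace_Hom_Omega : is_subspace (Hom_Omega Gamma s).
Proof.
split=> [|c _ _ [phi _ <-] [psi _ <-]]; first exact: Hom_Omega0.
have [|chi chiE] := @additive_of_fun _ Gamma s (fun alpha => c * phi alpha + psi alpha).
  by move=> alpha beta; rewrite !raddfD mulrDr addrACA.
exists chi => //; apply/esym/sv_diag_eqP => [k u v|b alpha p _]; rewrite !fctE.
  rewrite !sv_diag_linear !scalerDr !scalerA [k * c]mulrC addrACA //.
by rewrite !sv_diag_poly chiE scalerDl scalerA.
Qed.

Lemma is_subspace_sv_deg alpha : is_subspace (sv_deg alpha).
Proof. exact: is_subspace_span. Qed.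

Lemma sv_poly_deg b alpha p : sv_deg alpha (sv_poly b (val alpha) p).
Proof.
have [A0 Al] := is_subspace_sv_deg alpha.
move: p; apply: poly_lin_ind => [|c p q Hp Hq|i]; first by rewrite sv_poly0.
  by rewrite sv_poly_linear; exact: Al.
by rewrite sv_polyXn; apply: sub_gen_smallest; exists i; case: b; [right|left].
Qed.

Lemma sv_deg_ind alpha (P : set SV) : is_subspace P ->
  (forall b p, sv_valid b (val alpha) -> P (sv_poly b (val alpha) p)) ->
  sv_deg alpha `<=` P.
Proof.
move=> sP Pp; apply: span_sub => // v [i vE].
have [b ->] : exists b, v = sv_poly b (val alpha) 'X^i.
  by case: vE => ->; [exists false|exists true]; rewrite sv_polyXn.
have [bx|bx] := boolP (sv_valid b (val alpha)); first exact: Pp.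
by rewrite sv_poly_invalid //; case: sP.
Qed.

Lemma sv_deg_comp alpha b y v : sv_deg alpha v -> y != val alpha -> sv_comp b y v = 0.
Proof.
move=> va ya; move: v va; apply: sv_deg_ind => [|a p ax] /=.
  split=> [|c u v /= Hu Hv]; rewrite /= ?linear0 //.
  by rewrite sv_comp_linear Hu Hv scaler0 addr0.
by rewrite sv_comp_poly // -pair_eqE /= [val alpha == y]eq_sym (negbTE ya) andbF.
Qed.

Lemma is_subspace_Der_deg gamma : is_subspace (Der_deg gamma).
Proof.
have [D0 Dl] := is_subspace_Der SV.
split=> [|c D D' [hD Dd] [hD' Dd']].
  by split=> // alpha v _; have [] := is_subspace_sv_deg (alpha + gamma).
split=> [|alpha v va]; first exact: Dl.
by have [_] := is_subspace_sv_deg (alpha + gamma); apply; [exact: Dd|exact: Dd'].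
Qed.

Lemma Hom_Omega_sub_Der_deg0 : Hom_Omega Gamma s `<=` Der_deg 0.
Proof.
move=> _ [phi _ <-]; split=> [|alpha v va].
  by apply: Der_homogeneous_sub (sv_diag_Der_homogeneous phi).
by rewrite addr0 (sv_diag_deg _ va); exact: is_subspaceZ (is_subspace_sv_deg alpha) va.
Qed.

Lemma sv_bracket_poly_deg b gamma p : sv_valid b (val gamma) ->
  (ad SV `&` Der_deg gamma) (sv_bracket (sv_poly b (val gamma) p)).
Proof.
move=> bg; have zad : ad SV (sv_bracket (sv_poly b (val gamma) p)).
  by exists (sv_poly b (val gamma) p).
split=> //; split=> [|alpha]; first exact: ad_sub_Der.
apply: sv_deg_ind => [|a q aa] /=.
  by apply: is_subspace_preimage; [exact: sv_bracket_linearr|exact: is_subspace_sv_deg].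
by rewrite sv_bracket_poly_valid // addrC; exact: sv_poly_deg.
Qed.

Lemma ad_lin_ind (S : set (SV -> SV)) : is_subspace S ->
  (forall b x i, sv_valid b x -> S (sv_bracket (sv_poly b x 'X^i))) -> ad SV `<=` S.
Proof.
move=> sS SX; have [P0 Pl] := is_subspace_lie sS.
by move=> _ [z _ <-]; move: z; exact: (sv_lin_ind P0 Pl SX).
Qed.

(** A generator of the algebra has a single degree, so its inner derivation is a one-term family;
    linearity does the rest. *)
Lemma ad_finsupp_sum : ad SV `<=` [set w | exists2 f : Omega -> SV -> SV,
  finsupp_in (fun gamma => ad SV `&` Der_deg gamma) f &
    w = \sum_(i \in [set: Omega]) f i].
Proof.
have sA gamma : is_subspace (ad SV `&` Der_deg gamma).
  by apply: is_subspaceI; [exact: is_subspace_ad|exact: is_subspace_Der_deg].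
apply: ad_lin_ind => [|b x i bx]; first exact: is_subspace_finsupp_sums.
have [gamma gE] := sv_valid_Omega bx; subst x.
exists (single gamma (sv_bracket (sv_poly b (val gamma) 'X^i) : SV -> SV)).
  by apply: finsupp_in_single => //; exact: sv_bracket_poly_deg.
by rewrite fsbig_single.
Qed.

(** On [v] of degree alpha, the values [f k v] lie in the distinct degrees alpha + k, so projecting
    the zero sum to degree alpha + j leaves [f j v]. *)
Lemma Der_deg_independent (f : Omega -> SV -> SV) : finsupp_in Der_deg f ->
  \sum_(i \in [set: Omega]) f i = 0 -> forall i, f i = 0.
Proof.
move=> [ff fd] f0 j; have [fj _] := fd j; have fjl := Der_linear fj.
apply/funext; apply: sv_lin_ind => [|c u v Hu Hv|b x i bx].
- by have := fjl (-1) 0 0; rewrite !scaleN1r !addNr.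
- rewrite fjl Hu Hv -[RHS]/(0 : SV) -[X in _ *: X + _]/(0 : SV).
  by rewrite -[X in _ + X]/(0 : SV) scaler0 addr0.
have [alpha aE] := sv_valid_Omega bx; subst x; set v := sv_poly _ _ _.
have fdeg k : sv_deg (alpha + k) (f k v).
  by case: (fd k) => _; apply; exact: sv_poly_deg.
apply: sv_comp_eq0 => a y _; have [->|ya] := eqVneq y (val (alpha + j)); last first.
  exact: sv_deg_comp (fdeg j) ya.
rewrite -(@fsbig_component _ _ _ _ _ f v (sv_comp a (val (alpha + j))) j) //.
- by rewrite f0 -[X in sv_comp _ _ X]/(0 : SV) linear0.
- exact: sv_comp_linear.
move=> k kj; apply: sv_deg_comp (fdeg k) _.
by rewrite (inj_eq val_inj) (inj_eq (addrI alpha)) eq_sym.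
Qed.

(** A diagonal derivation kills every L_0(p), so an inner one of this kind comes from [z]
    centralizing L_0(1) and L_0(t). On a component q of [z] this means y q + q' = 0 and then, by
    [sv_poly_bracketX], that a nonzero constant times q is zero. *)
Lemma ad_Hom_Omega_disjoint : ad SV `&` Hom_Omega Gamma s = [set 0].
Proof.
apply/seteqP; split=> [D [[z _ zE] [phi _ phiE]]|_ ->]; last first.
  by split; [case: (is_subspace_ad SV)|case: is_subspace_Hom_Omega].
have V0 := sv_valid0 Gamma s.
have diag0 p : sv_diag phi (sv_poly false 0 p) = 0.
  by rewrite -[X in sv_poly _ X]/(val (0 : Omega)) sv_diag_poly raddf0 scale0r.
have z0 p : sv_bracket (sv_poly false 0 p) z = 0.
  apply: oppr_inj; rewrite -sv_bracket_antisym0 ?oppr0; last exact: sv_poly_part.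
  by rewrite -[sv_bracket z]/(lie z) zE -phiE diag0.
suff -> : D = sv_bracket z.
  rewrite (_ : z = 0); first by apply/funext => v; rewrite sv_bracket0l.
  apply: sv_comp_eq0 => b y bY.
  have := congr1 (sv_comp b y) (z0 1).
  rewrite sv_comp_bracketL0 linear0 sv_poly_bracket1 => z1.
  have := congr1 (sv_comp b y) (z0 'X).
  rewrite sv_comp_bracketL0 linear0 sv_poly_bracketX z1.
  rewrite mulr0 sub0r => /eqP; rewrite oppr_eq0 scaler_eq0 => /orP[|/eqP//].
  by case: (b); rewrite ?invr_eq0 ?pnatr_eq0 ?oner_eq0.
by rewrite -zE.
Qed.

Section Decomposition.
Hypothesis s2 : 2 * s \in Gamma.

Lemma Der_decomp : Der SV = sum_set (ad SV) (Hom_Omega Gamma s).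
Proof.
have sW := is_subspace_sum_set (is_subspace_ad SV) is_subspace_Hom_Omega.
apply/seteqP; split=> [_ [D0 hD0 [D1 hD1 <-]]|_ [D hD [D' hD' <-]]].
  suff W e D : Der_homogeneous e D -> sum_set (ad SV) (Hom_Omega Gamma s) D.
    by apply: is_subspaceD => //; [exact: W hD0|exact: W hD1].
  move=> hD; have [z [phi ->]] := Der_homogeneous_decomp s2 hD.
  by exists (sv_bracket z); [exists z|exists (sv_diag phi) => //; exists phi].
apply: is_subspaceD; [exact: is_subspace_Der|exact: ad_sub_Der|].
by have [] := Hom_Omega_sub_Der_deg0 hD'.
Qed.

Lemma Der_deg_direct_sum : is_direct_sum (Der SV) Der_deg.
Proof.
split; [exact: is_subspace_Der_deg| |exact: Der_deg_independent].
apply/seteqP; split=> [D|_ [f [ff fd] ->]]; last first.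
  by apply: is_subspace_fsbig => // [|i]; [exact: is_subspace_Der|case: (fd i)].
rewrite Der_decomp => -[D1 /ad_finsupp_sum hD1 [D2 hD2 <-]].
apply: is_subspaceD; first exact: is_subspace_finsupp_sums is_subspace_Der_deg.
  by case: hD1 => f [ff fd] ->; exists f => //; split=> // i; case: (fd i).
exists (single 0 D2); last by rewrite fsbig_single.
by apply: finsupp_in_single; [exact: is_subspace_Der_deg|exact: Hom_Omega_sub_Der_deg0].
Qed.

(** The diagonal part of [D] sits in degree 0, so in degree gamma uniqueness of components
    identifies [D] with an inner derivation. *)
Lemma Der_deg_sub_ad gamma : gamma != 0 -> Der_deg gamma `<=` ad SV.
Proof.
move=> g0 D Dg; have [DD _] := Dg; move: DD; rewrite Der_decomp.
move=> -[D1 /ad_finsupp_sum[g [gf gd] D1E] [D2 hD2 DE]].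
have sD := is_subspace_Der_deg.
have gS : finsupp_in Der_deg g by split=> // i; case: (gd i).
have S1 := finsupp_in_single sD Dg.
have S2 := finsupp_in_single sD (Hom_Omega_sub_Der_deg0 hD2).
(* This family consists of -D in degree gamma, the inner components [g], and [D2] in degree 0; its
   sum is zero. *)
have S3 := finsupp_in_lin sD (-1) S1 (finsupp_in_lin sD 1 gS S2).
have := Der_deg_independent S3.
rewrite fsbig_lin; [|by case: S1|by case: (finsupp_in_lin sD 1 gS S2)].
rewrite fsbig_lin; [|by case: gS|by case: S2].
rewrite !fsbig_single -D1E scale1r scaleN1r DE addNr => /(_ erefl gamma).
rewrite /single eqxx (negbTE g0) addr0 scale1r scaleN1r addrC => /eqP.
by rewrite subr_eq0 => /eqP <-; case: (gd gamma).
Qed.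

Lemma Der_deg0_direct_sum : is_direct_sum2 (Der_deg 0)
  (ad SV `&` Der_deg 0) (Hom_Omega Gamma s).
Proof.
have sD := is_subspace_Der_deg 0.
split; first by apply: is_subspaceI => //; exact: is_subspace_ad.
- exact: is_subspace_Hom_Omega.
- apply/seteqP; split=> [D D0|_ [D1 [_ D10] [D2 hD2 <-]]]; last first.
    by apply: is_subspaceD => //; exact: Hom_Omega_sub_Der_deg0.
  have [DD _] := D0; move: DD; rewrite Der_decomp => -[D1 hD1 [D2 hD2 DE]].
  exists D1; last by exists D2.
  (* The inner part has degree 0 as a difference of two maps of degree 0. *)
  split=> //; rewrite (_ : D1 = D - D2); last by rewrite -DE addrK.
  by apply: is_subspaceB => //; exact: Hom_Omega_sub_Der_deg0.
have /seteqP[sub0 _] := ad_Hom_Omega_disjoint.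
apply/seteqP; split=> [D [[Dad _] DH]|_ ->]; first exact: sub0.
split; first by split; [case: (is_subspace_ad SV)|case: sD].
by case: is_subspace_Hom_Omega.
Qed.

End Decomposition.
End Grading.

Theorem theorem3p6 (R : realType) (Gamma : zmodClosed R[i]) (s : R[i])
    (Z_sub_Gamma : forall n : int, n%:~R \in Gamma)
    (two_s_Gamma : 2 * s \in Gamma) :
  [/\ is_direct_sum (Der (SV Gamma s)) (@Der_deg _ Gamma s),
      is_direct_sum2 (Der (SV Gamma s)) (ad (SV Gamma s)) (Hom_Omega Gamma s),
      forall gamma : Omega Gamma s, gamma != 0 ->
        Der_deg gamma `<=` ad (SV Gamma s)
    & is_direct_sum2 (Der_deg (0 : Omega Gamma s))
        (ad (SV Gamma s) `&` Der_deg (0 : Omega Gamma s))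
        (Hom_Omega Gamma s)].
Proof.
split.
- exact: Der_deg_direct_sum.
- split; [exact: is_subspace_ad|exact: is_subspace_Hom_Omega|exact: Der_decomp|].
  exact: ad_Hom_Omega_disjoint.
- by move=> gamma; exact: Der_deg_sub_ad.
- exact: Der_deg0_direct_sum.
Qed.
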